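(* Let $\phi \in L^{\infty}(\mathbb{R})$ and $\alpha \in \mathbb{R}$. Consider the following two (equivalent) conditions on $\phi$: (1) for every $s \in \mathbb{R}$, $W(\phi_s - \phi) = 0$, i.e. $\phi_{x+s} - \phi_x \to 0$ in the weak*-topology of $L^{\infty}(\mathbb{R})$ as $x \to \infty$; (2) $\lim_{x \to \infty}\int_{-\infty}^{\infty}\phi(x-t)f(t)dt = 0$ for some $f \in L^1(\mathbb{R})$ with $Z(f) = \{0\}$. Then $W(\phi) = \alpha$ if and only if $P(\phi) = \alpha$ and one of the conditions (1), (2) holds. In other words, either of the conditions (1), (2) is a Tauberian condition under which $P(\phi) = \alpha$ implies $\lim_{x \to \infty}\int_{-\infty}^{\infty}\phi(x-t)f(t)dt = \alpha$ for a Wiener kernel $f \in L^1(\mathbb{R})$ with $\hat{f}(0) = 1$.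
   Context: All functions are real-valued. $\hat{f}(\xi) = \int_{-\infty}^{\infty} f(x)e^{-i\xi x}dx$ and $Z(f) = \{\xi \in \mathbb{R} : \hat{f}(\xi) = 0\}$; $f \in L^1(\mathbb{R})$ is a Wiener kernel if $Z(f) = \emptyset$. For $s \in \mathbb{R}$, $\phi_s(x) = \phi(x+s)$. $L^{\infty}(\mathbb{R})$ is regarded as the dual of $L^1(\mathbb{R})$. $W(\phi) = \alpha$ means that $\phi_s$ converges to the constant function $\alpha$ in the weak*-topology of $L^{\infty}(\mathbb{R})$ as $s \to \infty$. For $\phi \in L^{\infty}(\mathbb{R})$, \[\overline{P}(\phi) = \lim_{\theta \to \infty}\limsup_{x \to \infty}\frac{1}{\theta}\int_x^{x+\theta}\phi(t)dt, \qquad \underline{P}(\phi) = -\overline{P}(-\phi),\] and $P(\phi) = \alpha$ means $\overline{P}(\phi) = \underline{P}(\phi) = \alpha$. *)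

(* Defs.v *)
From HB Require Import structures.
From mathcomp Require Import all_boot all_order all_algebra.
From mathcomp Require Import complex.
From mathcomp Require Import all_classical all_reals all_analysis.
From mathcomp Require Import ess_sup_inf measurable_realfun.

Set Implicit Arguments.
Unset Strict Implicit.
Unset Printing Implicit Defensive.

Import Order.TTheory GRing.Theory Num.Theory.
Import numFieldNormedType.Exports.

Local Open Scope classical_set_scope.
Local Open Scope ring_scope.
Local Open Scope complex_scope.

(* Elements of L^1 and L^oo are represented by Borel measurable functions;
   the notions below depend only on their classes modulo a.e. equality. *)
Notation L1 R :=
  (LfunType (@lebesgue_measure R) (lexx (1%E : \bar R))).
Notation Linfty R :=
  (LfunType (@lebesgue_measure R) (leey (1%E : \bar R))).

Section Defs.
Variable R : realType.

Local Notation mu := (@lebesgue_measure R).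

Lemma LinftyP (g : R -> R) : measurable_fun setT g ->
  (exists M : R, \forall x \ae mu, `|g x| <= M) -> g \in Lfun mu +oo%E.
Proof.
move=> mg [M gM]; apply/andP; split; rewrite inE//=.
rewrite /finite_norm unlock /=; case: ifPn => // _.
apply: (@le_lt_trans _ _ M%:E); last exact: ltry.
apply/ess_supP; apply: negligibleS gM => x /=.
by rewrite lee_fin.
Qed.

Lemma Linfty_bounded (g : Linfty R) :
  exists M : R, \forall x \ae mu, `|g x| <= M.
Proof.
have mu0 : (0 < mu setT)%E.
  by rewrite -set_itvNyy lebesgue_measure_itv/= addye// ltry.
have /andP[_] := LfunP g; rewrite inE/= /finite_norm unlock /= mu0.
rewrite (_ : _ \o _ = EFin \o (Num.norm \o g))//.
exact: ess_supr_bounded.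
Qed.

Lemma measurable_translation (s : R) : measurable_fun [set: measurableTypeR R]
  ((fun x => x + s) : _ -> measurableTypeR R).
Proof. exact: measurable_funD. Qed.

Lemma negligible_translate (s : R) (A : set R) : mu.-negligible A ->
  mu.-negligible [set x | A (x + s)].
Proof.
have mshift := measurable_translation s.
move=> [B [mB B0 AB]]; exists [set x | B (x + s)]; split.
- by rewrite -[X in measurable X]setTI; exact: measurable_translation.
- rewrite -[RHS]B0; apply/esym; move: B mB {B0 AB}.
  pose nu := pushforward mu ((fun x => x + s) : _ -> measurableTypeR R).
  apply: (@lebesgue_measure_unique _ nu) => _ [[a b]] _ <-.
  transitivity (mu `]a - s, b - s]%classic).
    rewrite !lebesgue_measure_itv/= !lte_fin ltrD2r -!EFinD.
    by case: ifP => // _; congr EFin; rewrite opprB addrA subrK.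
  congr (mu _); apply/seteqP; split => x /=;
    by rewrite !in_itv/= ltrBlDr lerBrDr.
- by move=> x /= /AB.
Qed.

Lemma translate_in_Linfty (s : R) (phi : Linfty R) :
  (fun x => phi (x + s)) \in Lfun mu +oo%E.
Proof.
apply: LinftyP.
  have /andP[] := LfunP phi; rewrite inE => mphi _.
  exact: measurableT_comp mphi (measurable_translation s).
have [M hM] := Linfty_bounded phi; exists M.
have := negligible_translate s hM.
by apply: negligibleS => x.
Qed.

Definition translate (s : R) (phi : Linfty R) : Linfty R :=
  Lfun_Sub (leey _) (translate_in_Linfty s phi).

Lemma cst_in_Linfty (alpha : R) : (fun=> alpha) \in Lfun mu +oo%E.
Proof.
apply: LinftyP => //; exists `|alpha|.
by apply: negligibleS (negligible_set0 _) => x/=; rewrite lexx.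
Qed.

Definition cst_Linfty (alpha : R) : Linfty R :=
  Lfun_Sub (leey _) (cst_in_Linfty alpha).

Definition pairing (phi : Linfty R) (f : L1 R) : R :=
  \int[mu]_x (phi x * f x).

(* The weak*-topology of L^oo as the dual of L^1: the coarsest topology making
   all evaluations [pairing ^~ f] continuous. *)
Definition weak_star : topologicalType :=
  sup_topology (fun f : L1 R => Topological.on (initial_topology (pairing ^~ f))).

(* W(phi) = alpha *)
Definition W (phi : Linfty R) (alpha : R) : Prop :=
  translate s phi @[s --> +oo%R] --> (cst_Linfty alpha : weak_star).

Lemma WP (phi : Linfty R) (alpha : R) :
  W phi alpha <->
  forall f : L1 R, (\int[mu]_x (phi (x + s) * f x)) @[s --> +oo%R]
    --> \int[mu]_x (alpha * f x).
Proof.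
have FF : Filter (translate s phi @[s --> +oo%R]) by exact: fmap_filter.
pose T (f : L1 R) := Topological.on (initial_topology (pairing ^~ f)).
have [sup1 sup2] := @cvg_sup _ _ T _ (cst_Linfty alpha) FF.
rewrite /W; split=> [/sup1 cW f|cf].
  move=> A /(@initial_continuous (Linfty R) R (pairing ^~ f) (cst_Linfty alpha)).
  exact: cW.
apply: sup2 => f A [_ [[B oB <-] Ba BA]].
have /cf/= fB : nbhs (pairing (cst_Linfty alpha) f) B by exact: open_nbhs_nbhs.
exact: (filterS BA (F := translate s phi @[s --> +oo%R])).
Qed.

Definition Pupper (phi : Linfty R) : \bar R :=
  lim (limf_esup
         (fun x : R => (theta^-1 * \int[mu]_(t in `[x, (x + theta)%R]) phi t)%:E)
         +oo%R
       @[theta --> +oo%R]).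

Definition Plower (phi : Linfty R) : \bar R := (- Pupper (- phi)%R)%E.

(* P(phi) = alpha *)
Definition P (phi : Linfty R) (alpha : R) : Prop :=
  Pupper phi = alpha%:E /\ Plower phi = alpha%:E.

(* e^{it} *)
Definition expi (t : R) : R[i] := cos t +i* sin t.

Definition cintegral (g : R -> R[i]) : R[i] :=
  (\int[mu]_x complex.Re (g x)) +i* (\int[mu]_x complex.Im (g x)).

Definition fourier (f : L1 R) (xi : R) : R[i] :=
  cintegral (fun x => (f x)%:C * expi (- (xi * x))).

Definition Z (f : L1 R) : set R := [set xi | fourier f xi = 0].

Definition Wiener_kernel (f : L1 R) : Prop := Z f = set0.

Definition convolution (phi : Linfty R) (f : L1 R) (x : R) : R :=
  \int[mu]_t (phi (x - t) * f t).

Definition condition1 (phi : Linfty R) : Prop :=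
  forall s : R, W (translate s phi - phi) 0.

Definition condition2 (phi : Linfty R) : Prop :=
  exists f : L1 R, Z f = [set 0] /\ convolution phi f x @[x --> +oo%R] --> (0 : R).

End Defs.

(* Main.v *)
Require Import Defs.
From HB Require Import structures.
From mathcomp Require Import all_boot all_order all_algebra.
From mathcomp Require Import complex.
From mathcomp Require Import all_classical all_reals all_analysis.
From mathcomp Require Import ring lra measurable_realfun.

Import Order.TTheory GRing.Theory Num.Theory.
Import numFieldNormedType.Exports.
Local Open Scope classical_set_scope.
Local Open Scope ring_scope.

(** Work with a bounded representative [p] of [phi]. The heart is (2) => (1), a
    Wiener theorem for a kernel [f] whose transform vanishes only at 0. Let [k_A]
    be the cosine transform of a C^2 profile [A] on [a, b], with [a > 0], and let
    [q] be a truncation of [f] with [|f - q|_1 <= e]. Convolving [p * k_A] with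
    [f] and its reflection gives a function tending to 0, whereas convolving it
    with [q] and its reflection gives [p * k_(Q A)], where [Q] is the squared
    modulus of the transform of [q]; so [limsup |p * k_(Q A)|] is at most
    [2 e |f|_1 limsup |p * k_A|]. Take [A = D / Q^n]: as in Newman's proof of
    Wiener's lemma, [1 / Q] is smooth and [|k_A|_1] grows only geometrically in
    [n], with a ratio that the factor [2 e |f|_1] beats. Hence [p * k_D] tends to
    0. This applies to [k_D = V_l - V_m], where the [V_l] are dilates of a kernel
    whose profile is 1 near 0: for large [l] they are an approximate identity, and
    for small [m] they annihilate differences of translates, so
    [(p * h)(x + s) - (p * h)(x)] tends to 0 for every integrable [h].

    Under (1), averaging by [h] and by a kernel [K] of integral 1 commute, so that
    [p * h - (int h) p * K] tends to 0. A mean-zero kernel whose transform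
    vanishes only at 0 then gives (2), and taking for [h] and [K] uniform kernels
    shows that the means over windows of any length have the same upper limit. *)

Set Implicit Arguments.
Unset Strict Implicit.
Unset Printing Implicit Defensive.

(** * Real-valued Lebesgue integrals: affine substitution, dominated convergence, Fubini *)

Section RealIntegrals.
Context {R : realType}.
Local Notation mu := (@lebesgue_measure R).

(** Fourier inversion is avoided: kernels are given as transforms of profiles, so that convolving
    one with [q] acts on its profile by Fubini alone. The one trace of inversion, that the integral
    of the kernel with profile 1 near 0 is not 0, is obtained as an inequality. All integrals are
    real. Since real functions have transforms of even modulus, frequencies [y >= 0] suffice, and
    convolving with the reflection as well cancels the phase of the transform of [q], which keeps
    the profile real.

    The transform of [f] need not be differentiable, hence the truncation [q]; but the derivatives
    of [1 / Q] then depend on [q], thus on [e], and could spoil the ratio that has to be beaten.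
    They do not, because they are absorbed in a scale [L], fixed once for all [n], that enters the
    L1 norms only through a constant factor. The ratio involves nothing but the sup of [1 / Q],
    which is controlled by the minimum of the squared modulus of the transform of [f] on [[a, b]].
    So [e] can be chosen before [q] and [L]. *)

Definition integ (f : R -> R) : Prop := mu.-integrable [set: R] (EFin \o f).

Lemma integ_meas f : integ f -> measurable_fun [set: R] f.
Proof. by move=> /measurable_int/measurable_EFinP. Qed.

Lemma integ_norm f : integ f -> integ (fun x => `|f x|).
Proof. exact: integrable_norm. Qed.

Lemma integD f g : integ f -> integ g -> integ (fun x => f x + g x).
Proof. by move=> fi gi; exact: (integrableD measurableT fi gi). Qed.

Lemma integB f g : integ f -> integ g -> integ (fun x => f x - g x).
Proof. by move=> fi gi; exact: (integrableB measurableT fi gi). Qed.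

Lemma integZ (k : R) f : integ f -> integ (fun x => k * f x).
Proof. by move=> fi; exact: (integrableZl measurableT k fi). Qed.

Lemma integ_le (f g : R -> R) : measurable_fun [set: R] f -> integ g ->
  (forall x, `|f x| <= g x) -> integ f.
Proof.
move=> mf gi fg; apply: (le_integrable measurableT _ _ gi).
  exact/measurable_EFinP.
move=> x _ /=; rewrite lee_fin; apply: le_trans (fg x) (ler_norm _).
Qed.

Lemma integ_bM (u : R -> R) M (f : R -> R) : measurable_fun [set: R] u -> (forall x, `|u x| <= M) ->
  integ f -> integ (fun x => u x * f x).
Proof.
move=> mu_ uM fi; apply: (@integ_le _ (fun x => M * `|f x|)).
- by apply: measurable_funM => //; exact: integ_meas.
- exact/integZ/integ_norm.
- by move=> x; rewrite normrM ler_wpM2r.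
Qed.

Lemma Rint_norm f : integ f -> `|\int[mu]_x f x| <= \int[mu]_x `|f x|.
Proof. exact: le_normr_Rintegral. Qed.

Lemma Rint_le (f g : R -> R) : integ f -> integ g -> (forall x, f x <= g x) ->
  \int[mu]_x f x <= \int[mu]_x g x.
Proof. by move=> fi gi fg; exact: le_Rintegral. Qed.

Lemma Rint_norm_le (f g : R -> R) : measurable_fun [set: R] f -> integ g ->
  (forall x, `|f x| <= g x) -> `|\int[mu]_x f x| <= \int[mu]_x g x.
Proof.
move=> mf gi fg; have fi := integ_le mf gi fg.
apply: (le_trans (Rint_norm fi)); apply: Rint_le => //; exact: integ_norm.
Qed.

Lemma eq_Rint (f g : R -> R) : f =1 g -> \int[mu]_x f x = \int[mu]_x g x.
Proof. by move=> fg; apply: eq_Rintegral => x _. Qed.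

Lemma EFin_Rint f : integ f -> (\int[mu]_x f x)%:E = (\int[mu]_x (f x)%:E)%E.
Proof. by move=> fi; rewrite fineK//; exact: integrable_fin_num. Qed.

Section affine.
Variables (a b : R) (a0 : a != 0).
Let phi : measurableTypeR R -> measurableTypeR R := fun x => a * x + b.

Lemma measurable_affine : measurable_fun [set: measurableTypeR R] phi.
Proof. by apply: measurable_funD => //; apply: measurable_funM. Qed.

Let c : {nonneg R} := NngNum (etrans (invr_ge0 _) (normr_ge0 a)).

Lemma pushforward_affine A : measurable A ->
  pushforward mu phi A = mscale c mu A.
Proof.
move=> mA.
pose k : {nonneg R} := NngNum (normr_ge0 a).
have mphi := measurable_affine.
have E : lebesgue_measure A = (`|a|%:E * mu (phi @^-1` A))%E.
  unshelve refine (@lebesgue_measure_unique R (mscale k (pushforward mu phi)) _ A mA).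
    exact: mphi.
  move=> _ [[x y]] _ <-; rewrite -[RHS]/(`|a|%:E * mu (phi @^-1` _))%E/=.
  (* For [a < 0] the preimage of a left-open interval is right-open; its length is the same. *)
  case: (ltgtP a 0) a0 => // ha _.
  - rewrite (_ : phi @^-1` _ = `[(y - b) / a, (x - b) / a[%classic).
      rewrite !lebesgue_measure_itv/= !lte_fin ltr_nM2r ?invr_lt0// ltrD2r.
      case: ifPn => xy; last by rewrite mule0.
      rewrite -!EFinD -EFinM ltr0_norm//; congr EFin; field; lra.
    apply/seteqP; split=> z /=; rewrite !in_itv/= /phi.
      rewrite ler_ndivrMr// ltr_ndivlMr// (mulrC z) => /andP[? ?]; lra.
    rewrite ler_ndivrMr// ltr_ndivlMr// (mulrC z) => /andP[? ?]; lra.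
  - rewrite (_ : phi @^-1` _ = `](x - b) / a, (y - b) / a]%classic).
      rewrite !lebesgue_measure_itv/= !lte_fin ltr_pM2r ?invr_gt0// ltrD2r.
      case: ifPn => xy; last by rewrite mule0.
      rewrite -!EFinD -EFinM gtr0_norm//; congr EFin; field; lra.
    apply/seteqP; split=> z /=; rewrite !in_itv/= /phi.
      rewrite ltr_pdivrMr// ler_pdivlMr// (mulrC z) => /andP[? ?]; lra.
    rewrite ltr_pdivrMr// ler_pdivlMr// (mulrC z) => /andP[? ?]; lra.
rewrite -[RHS]/(`|a|^-1%:E * lebesgue_measure A)%E -[LHS]/(mu (phi @^-1` A)).
rewrite E muleA -EFinM mulVf ?normr_eq0// mul1e //.
Qed.

Lemma ge0_integral_affine (h : R -> \bar R) :
  measurable_fun [set: R] h -> (forall x, (0 <= h x)%E) ->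
  (\int[mu]_x h (a * x + b)%R = `|a|^-1%:E * \int[mu]_x h x)%E.
Proof.
move=> mh h0.
have mphi := measurable_affine.
have := ge0_integral_pushforward measurable_affine mu measurableT mh (fun y _ => h0 y).
rewrite preimage_setT => <-.
rewrite -(@ge0_integral_mscale _ _ _ _ _ _ c)//.
by apply: eq_measure_integral => A mA _; exact: pushforward_affine.
Qed.

Lemma integ_affine (h : R -> R) : integ h -> integ (fun x => h (a * x + b)).
Proof.
move=> /integrableP[/measurable_EFinP mh hoo]; apply/integrableP; split.
  apply/measurable_EFinP.
  exact: (@measurableT_comp _ _ _ _ _ _ _ _ phi mh measurable_affine).
have := @ge0_integral_affine (fun x => `|(h x)%:E|%E).
move=> /= -> //; first by rewrite lte_mul_pinfty// lee_fin.
by apply/measurable_EFinP; exact: measurableT_comp.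
Qed.

Lemma Rint_affine (h : R -> R) : integ h ->
  \int[mu]_x h (a * x + b) = `|a|^-1 * \int[mu]_x h x.
Proof.
move=> hi; have mh := integ_meas hi.
have mEh : measurable_fun [set: R] (EFin \o h) by exact/measurable_EFinP.
apply: EFin_inj; rewrite EFinM !EFin_Rint//; last exact: integ_affine.
rewrite integralE [in RHS]integralE.
have := ge0_integral_affine (measurable_funepos mEh) (fun=> funepos_ge0 _ _).
have := ge0_integral_affine (measurable_funeneg mEh) (fun=> funeneg_ge0 _ _).
move=> /= E1 E2.
transitivity (`|a|^-1%:E * \int[mu]_x (EFin \o h)^\+ x -
   `|a|^-1%:E * \int[mu]_x (EFin \o h)^\- x)%E.
  by rewrite -E1 -E2; congr (_ - _)%E; apply: eq_integral => x _; rewrite !(funeposE, funenegE).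
rewrite -muleBr// fin_num_adde_defr//.
by apply: integrable_pos_fin_num => //; exact: hi.
Qed.

End affine.

Lemma integ_shift (s : R) h : integ h -> integ (fun x => h (x + s)).
Proof.
move=> /(integ_affine s (oner_neq0 _)).
by congr (mu.-integrable _ _); apply/funext => x /=; rewrite mul1r.
Qed.

Lemma Rint_shift (s : R) h : integ h -> \int[mu]_x h (x + s) = \int[mu]_x h x.
Proof.
move=> /(Rint_affine s (oner_neq0 _)); rewrite normr1 invr1 mul1r => <-.
by apply: eq_Rint => x; rewrite mul1r.
Qed.

Lemma integ_refl (s : R) h : integ h -> integ (fun x => h (s - x)).
Proof.
have n1 : -1 != 0 :> R by rewrite oppr_eq0 oner_neq0.
move=> /(integ_affine s n1).
by congr (mu.-integrable _ _); apply/funext => x /=; rewrite mulN1r addrC.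
Qed.

Lemma Rint_refl (s : R) h : integ h -> \int[mu]_x h (s - x) = \int[mu]_x h x.
Proof.
have n1 : -1 != 0 :> R by rewrite oppr_eq0 oner_neq0.
move=> /(Rint_affine s n1); rewrite normrN1 invr1 mul1r => <-.
by apply: eq_Rint => x; rewrite mulN1r addrC.
Qed.

Lemma dct (f_ : nat -> R -> R) (f g : R -> R) :
  (forall n, measurable_fun [set: R] (f_ n)) -> integ g ->
  (forall n x, `|f_ n x| <= g x) ->
  (forall x, f_ n x @[n --> \oo] --> f x) ->
  \int[mu]_x f_ n x @[n --> \oo] --> \int[mu]_x f x.
Proof.
move=> mf gi fg ff.
have mlim : measurable_fun [set: R] f.
  by apply: measurable_fun_cvg => //= x _; exact: ff.
have [fi _ cv] : [/\ integ f,
  [sequence \int[mu]_x `|(f_ n x)%:E - (f x)%:E|]_n @ \oo --> 0 &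
  [sequence \int[mu]_x (f_ n x)%:E]_n @ \oo --> \int[mu]_x (f x)%:E]%E.
  apply: (@dominated_convergence _ _ R mu _ measurableT
    (fun n => EFin \o f_ n) (EFin \o f) (EFin \o g)) => //.
  - by move=> n; apply/measurable_EFinP; exact: mf.
  - by apply/measurable_EFinP; exact: mlim.
  - apply: aeW => x _; apply: cvg_EFin; last exact: ff.
    exact: nearW.
  - by apply: aeW => x n _; rewrite /= lee_fin.
apply: fine_cvg; rewrite EFin_Rint//.
Qed.

Lemma dct_pinfty (F : R -> R -> R) (f g : R -> R) :
  (forall s, measurable_fun [set: R] (F s)) -> integ g ->
  (forall s x, `|F s x| <= g x) ->
  (forall x, F s x @[s --> +oo] --> f x) ->
  \int[mu]_x F s x @[s --> +oo] --> \int[mu]_x f x.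
Proof.
move=> mF gi Fg Ff; apply/cvg_pinftyP => u uoo.
apply: (@dct (fun n => F (u n)) f g) => // x.
by have /cvg_pinftyP := Ff x; exact.
Qed.

Section fubini.
Variables (F : R -> R -> R) (H : R -> R).
Hypothesis mF : measurable_fun [set: R * R] (fun z => F z.1 z.2).
Hypothesis iF1 : forall y, integ (fun x => F x y).
Hypothesis iF2 : forall x, integ (F x).
Hypothesis iH : integ H.
Hypothesis FH : forall y, \int[mu]_x `|F x y| <= H y.

Let iF : (mu \x mu)%E.-integrable [set: R * R] (fun z => (F z.1 z.2)%:E).
Proof.
apply/integrable21ltyP; first exact/measurable_EFinP.
have /integrableP[_] := iH; apply: le_lt_trans.
apply: ge0_le_integral => //.
- by move=> x _; exact: integral_ge0.
- have := @measurable_fun_fubini_tonelli_G _ _ _ _ R mu (fun z => `|(F z.1 z.2)%:E|%E).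
  apply; last by move=> z; exact: abse_ge0.
  apply/measurable_EFinP.
  exact: (@measurableT_comp _ _ _ _ _ _ _ _ _ (@normr_measurable R setT) mF).
- by apply: measurableT_comp => //; exact: measurable_int iH.
- move=> y _.
  rewrite -[X in (X <= _)%E]/(\int[mu]_x (`|F x y|)%:E)%E -EFin_Rint ?lee_fin//.
    exact: le_trans (FH y) (ler_norm _).
  exact: integ_norm.
Qed.

(** Sections are assumed integrable for every point, not almost every, so that each inner extended
    integral is the image of a real one. The bound [H] on the inner norms gives integrability on the
    plane by Tonelli. *)
Lemma Rfubini :
  \int[mu]_x \int[mu]_y F x y = \int[mu]_y \int[mu]_x F x y.
Proof.
rewrite /Rintegral; congr fine.
have := @Fubini _ _ _ _ R mu mu _ iF => /=.
by under eq_integral do rewrite -EFin_Rint//; under [in RHS]eq_integral do rewrite -EFin_Rint//.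
Qed.

Lemma integ_fubini1 : integ (fun x => \int[mu]_y F x y).
Proof.
have := @integrable_fubini_F _ _ _ _ R mu mu _ iF.
congr (mu.-integrable _ _); apply/funext => x /=.
by rewrite /fubini_F/= -EFin_Rint.
Qed.

End fubini.

End RealIntegrals.

(** * Convolution of a bounded function with integrable kernels *)

Section Convolution.
Context {R : realType}.
Local Notation mu := (@lebesgue_measure R).

Definition cv (u f : R -> R) (x : R) : R := \int[mu]_t (u (x - t) * f t).

(* The bound is pointwise, not merely essential. *)
Definition bm (u : R -> R) (M : R) : Prop :=
  measurable_fun [set: R] u /\ forall x, `|u x| <= M.

Lemma bm_ge0 u M : bm u M -> 0 <= M.
Proof. by move=> [_ /(_ 0)]; apply: le_trans. Qed.

Lemma bm_refl u M (x : R) : bm u M -> bm (fun t => u (x - t)) M.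
Proof.
move=> [mu_ uM]; split=> [|t]; last exact: uM.
by apply: (measurableT_comp mu_); exact: measurable_funB.
Qed.

Lemma integ_cv u M f (x : R) : bm u M -> integ f ->
  integ (fun t => u (x - t) * f t).
Proof.
by move=> /(@bm_refl _ _ x)[? ?] fi; exact: integ_bM fi.
Qed.

Lemma measurable_cv2 (u f : R -> R) : measurable_fun [set: R] u ->
  measurable_fun [set: R] f ->
  measurable_fun [set: R * R] (fun z => u (z.1 - z.2) * f z.2).
Proof.
move=> mu_ mf; apply: measurable_funM.
  by apply: (measurableT_comp mu_); exact: measurable_funB.
exact: measurableT_comp.
Qed.

Lemma norm_cv_le u M f (x : R) : bm u M -> integ f ->
  `|cv u f x| <= M * \int[mu]_t `|f t|.
Proof.
move=> bu fi; have [mu_ uM] := bm_refl x bu.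
rewrite -RintegralZl//; last exact: integ_norm.
apply: Rint_norm_le.
- exact: integ_meas (integ_cv x bu fi).
- exact/integZ/integ_norm.
- by move=> t; rewrite normrM ler_wpM2r.
Qed.

Lemma integ_oneDsqrV : integ (fun x : R => (1 + x ^+ 2)^-1).
Proof.
have cV : continuous (fun x : R => (1 + x ^+ 2)^-1).
  exact: continuous_oneDsqrV.
apply/integrableP; split.
  by apply/measurable_EFinP; exact: continuous_measurable_fun.
pose w (x : R) := (1 + x ^+ 2)^-1.
rewrite (_ : (fun _ => _) = EFin \o w); last first.
  by apply/funext => x /=; rewrite ger0_norm// invr_ge0 addr_ge0// sqr_ge0.
rewrite (@ge0_symfun_integralT R w)//.
- rewrite (_ : [set x : R | 0 <= x] = `[0, +oo[%classic).
    by rewrite integral0y_oneDsqr -EFinM ltry.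
  by apply/seteqP; split=> x /=; rewrite in_itv/= andbT.
- by move=> x; rewrite invr_ge0 addr_ge0// sqr_ge0.
- by move=> x /=; rewrite /w sqrrN.
Qed.

(** Fubini yields measurability in [x] for integrands integrable on the plane, which
    [u (x - t) * f t] is not in general. Multiplying by the integrable weight [w x] makes it so, and
    the weight is divided out afterwards. *)
Lemma measurable_cv u M f : bm u M -> integ f -> measurable_fun [set: R] (cv u f).
Proof.
move=> bu fi; have [mu_ uM] := bu.
pose w (x : R) := (1 + x ^+ 2)^-1.
have w0 x : 0 < w x by rewrite invr_gt0 ltr_pwDl// sqr_ge0.
have w1 x : w x <= 1.
  by rewrite invf_le1 ?lerDl ?sqr_ge0// ltr_pwDl// sqr_ge0.
have mw : measurable_fun [set: R] w by exact: integ_meas integ_oneDsqrV.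
have wi : integ w by exact: integ_oneDsqrV.
have -> : cv u f = (fun x => (1 + x ^+ 2) * \int[mu]_t (w x * (u (x - t) * f t))).
  apply/funext => x; rewrite RintegralZl//; last exact: integ_cv bu fi.
  by rewrite mulrA divff ?mul1r// gt_eqF// ltr_pwDl// sqr_ge0.
apply: measurable_funM.
  by apply: measurable_funD => //; exact: measurable_funX.
apply: integ_meas.
have iF1 y : integ (fun x => w x * (u (x - y) * f y)).
  rewrite (_ : (fun _ => _) = (fun x => f y * (u (x - y) * w x))); last first.
    by apply/funext => x; ring.
  apply: integZ; apply: (@integ_bM _ (fun x => u (x - y)) M) => //.
  by apply: (measurableT_comp mu_); exact: measurable_funB.
apply: (@integ_fubini1 _ (fun x y => w x * (u (x - y) * f y))
    (fun y => M * \int[mu]_x w x * `|f y|)) => //.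
- apply: measurable_funM; first exact: (measurableT_comp mw).
  exact: measurable_cv2 (integ_meas fi).
- by move=> x; apply: integZ; exact: integ_cv bu fi.
- by apply: integZ; exact: integ_norm.
- move=> y; rewrite -RintegralZl// -RintegralZr//; last exact: integZ.
  apply: Rint_le.
  + exact: integ_norm.
  + have := integZ (`|f y|) (integZ M wi).
    by congr (mu.-integrable _ _); apply/funext => x /=; rewrite mulrC.
  + move=> x; rewrite !normrM mulrA ler_wpM2r// mulrC ler_pM//.
    by rewrite ger0_norm// ltW.
Qed.

Lemma bm_cv u M f : bm u M -> integ f -> bm (cv u f) (M * \int[mu]_t `|f t|).
Proof.
move=> bu fi; split; first exact: measurable_cv bu fi.
by move=> x; exact: norm_cv_le.
Qed.

Lemma cvBr u M f g x : bm u M -> integ f -> integ g ->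
  cv u (fun t => f t - g t) x = cv u f x - cv u g x.
Proof.
move=> bu fi gi; rewrite /cv -RintegralB//; [|exact: integ_cv bu _..].
by apply: eq_Rint => t; rewrite mulrBr.
Qed.

Lemma cvBl u M v M' f x : bm u M -> bm v M' -> integ f ->
  cv (fun t => u t - v t) f x = cv u f x - cv v f x.
Proof.
move=> bu bv fi; rewrite /cv -RintegralB//; last 2 first.
  exact: integ_cv bu _.
  exact: integ_cv bv _.
by apply: eq_Rint => t; rewrite mulrBl.
Qed.

(** Both sides are the double integral of [u (x - t - y) * f y * g t], in the two orders. *)
Lemma cv_comm u M f g x : bm u M -> integ f -> integ g ->
  cv (cv u f) g x = cv (cv u g) f x.
Proof.
move=> bu fi gi; have [mu_ uM] := bu.
pose F t y := u (x - t - y) * f y * g t.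
have msub : measurable_fun [set: R * R] (fun z => u (x - z.1 - z.2)).
  apply: (measurableT_comp mu_).
  by apply: measurable_funB => //; exact: measurable_funB.
have E1 : cv (cv u f) g x = \int[mu]_t \int[mu]_y F t y.
  apply: eq_Rint => t; rewrite /cv -RintegralZr//; exact: integ_cv bu fi.
have E2 : cv (cv u g) f x = \int[mu]_y \int[mu]_t F t y.
  apply: eq_Rint => y; rewrite /cv -RintegralZr//; last exact: integ_cv bu gi.
  apply: eq_Rint => t; rewrite /F mulrAC.
  by congr (u _ * _ * _); rewrite addrAC.
have iF1 y : integ (fun t => F t y).
  have := integZ (f y) (integ_cv (x - y) bu gi).
  congr (mu.-integrable _ _); apply/funext => t /=; congr EFin.
  by rewrite /F mulrA (mulrC (f y)); congr (u _ * _ * _); rewrite addrAC.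
rewrite E1 E2; apply: (@Rfubini _ F (fun y => M * (\int[mu]_t `|g t|) * `|f y|)) => //.
- apply: measurable_funM; last exact: (measurableT_comp (integ_meas gi)).
  by apply: measurable_funM => //; exact: (measurableT_comp (integ_meas fi)).
- move=> t; have := integZ (g t) (integ_cv (x - t) bu fi).
  by congr (mu.-integrable _ _); apply/funext => y /=; rewrite mulrC.
- by apply: integZ; exact: integ_norm.
- move=> y; rewrite -RintegralZl//; last exact: integ_norm.
  rewrite -RintegralZr//; last exact/integZ/integ_norm.
  apply: Rint_le; first exact: integ_norm.
  + have := integZ (`|f y|) (integZ M (integ_norm gi)).
    by congr (mu.-integrable _ _); apply/funext => t /=; rewrite mulrC.
  + by move=> t; rewrite /F mulrAC !normrM ler_wpM2r// ler_wpM2r.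
Qed.

Lemma integ_cvv g N f : bm g N -> integ g -> integ f -> integ (cv g f).
Proof.
move=> bg gi fi; have [mg gN] := bg.
apply: (@integ_fubini1 _ (fun x y => g (x - y) * f y)
    (fun y => (\int[mu]_x `|g x|) * `|f y|)) => //.
- exact: measurable_cv2 (integ_meas fi).
- move=> y; have := integZ (f y) (integ_shift (- y) gi).
  by congr (mu.-integrable _ _); apply/funext => t /=; rewrite mulrC.
- by move=> x; exact: integ_cv bg fi.
- by apply: integZ; exact: integ_norm.
- move=> y; under eq_Rintegral do rewrite normrM.
  rewrite RintegralZr//; last exact: (integ_shift (- y) (integ_norm gi)).
  by rewrite (Rint_shift (- y) (integ_norm gi)).
Qed.

(** Boundedness of [g] makes [cv g f] converge at every point. The kernels put in its place are
    cosine transforms or their convolutions, hence bounded. *)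
Lemma cv_assoc u M g N f x : bm u M -> bm g N -> integ g -> integ f ->
  cv (cv u g) f x = cv u (cv g f) x.
Proof.
move=> bu bg gi fi; have [mu_ uM] := bu; have [mg gN] := bg.
pose F w y := u (x - w) * (g (w - y) * f y).
have E2 : cv u (cv g f) x = \int[mu]_w \int[mu]_y F w y.
  by apply: eq_Rint => w; rewrite /cv -RintegralZl//; exact: integ_cv bg fi.
have iF1 y : integ (fun w => F w y).
  have := integZ (f y) (integ_cv x bu (integ_shift (- y) gi)).
  congr (mu.-integrable _ _); apply/funext => w /=; congr EFin.
  by rewrite /F mulrC mulrA.
have E1 : cv (cv u g) f x = \int[mu]_y \int[mu]_w F w y.
  apply: eq_Rint => y; rewrite /cv -RintegralZr//; last exact: integ_cv bu gi.
  rewrite -(Rint_shift (- y) (h := fun t => u (x - y - t) * g t * f y)).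
    apply: eq_Rint => w; rewrite /F mulrA; congr (u _ * _ * _).
    by rewrite opprB addrA subrK.
  have := integZ (f y) (integ_cv (x - y) bu gi).
  by congr (mu.-integrable _ _); apply/funext => t /=; rewrite mulrC.
rewrite E1 E2; apply/esym.
apply: (@Rfubini _ F (fun y => M * (\int[mu]_t `|g t|) * `|f y|)) => //.
- apply: measurable_funM; last exact: measurable_cv2 (integ_meas fi).
  by apply: (measurableT_comp mu_); exact: measurable_funB.
- move=> w; exact: integZ (integ_cv w bg fi).
- by apply: integZ; exact: integ_norm.
- move=> y; rewrite -(Rint_shift (- y) (integ_norm gi)).
  have gyi := integ_shift (- y) (integ_norm gi).
  rewrite -RintegralZl// -RintegralZr//; last exact: integZ.
  apply: Rint_le; first exact: integ_norm.
  + have := integZ (`|f y|) (integZ M gyi).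
    by congr (mu.-integrable _ _); apply/funext => t /=; rewrite mulrC.
  + by move=> w; rewrite /F mulrA !normrM ler_wpM2r// ler_wpM2r.
Qed.

End Convolution.

(** * Asymptotic bounds at infinity and their behaviour under convolution *)

Section LimsupBound.
Context {R : realType}.
Local Notation mu := (@lebesgue_measure R).

(* [limsup_(x -> +oo) |u x| <= c] *)
Definition lsup (u : R -> R) (c : R) : Prop :=
  forall e, 0 < e -> \forall x \near +oo, `|u x| <= c + e.

Lemma lsup_bm u M : bm u M -> lsup u M.
Proof.
by move=> [_ uM] e e0; apply: nearW => x; rewrite (le_trans (uM x))// lerDl ltW.
Qed.

Lemma lsup0P (u : R -> R) : lsup u 0 <-> u x @[x --> +oo] --> 0.
Proof.
split=> [u0|/cvgr0Pnorm_le u0 e e0]; last by rewrite add0r; exact: u0.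
by apply/cvgr0Pnorm_le => e e0; have := u0 e e0; rewrite add0r.
Qed.

Lemma lsup_le u (c d : R) : c <= d -> lsup u c -> lsup u d.
Proof.
move=> cd uc e e0; have := uc e e0; apply: filterS => x /le_trans; apply.
by rewrite lerD2r.
Qed.

Lemma lsupD (u v : R -> R) c d : lsup u c -> lsup v d ->
  lsup (fun x => u x + v x) (c + d).
Proof.
move=> uc vd e e0; have e2 : 0 < e / 2 by rewrite divr_gt0.
have := vd _ e2; have := uc _ e2; apply: filterS2 => x ux vx.
by apply: (le_trans (ler_normD _ _)); lra.
Qed.

Lemma lsupN (u : R -> R) c : lsup u c -> lsup (fun x => - u x) c.
Proof. by move=> uc e e0; have := uc _ e0; apply: filterS => x; rewrite normrN. Qed.

Lemma lsupB (u v : R -> R) c d : lsup u c -> lsup v d ->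
  lsup (fun x => u x - v x) (c + d).
Proof. by move=> uc vd; exact: lsupD uc (lsupN vd). Qed.

Lemma lsup_small u (c : R) : (forall e, 0 < e -> lsup u (c + e)) -> lsup u c.
Proof.
move=> uc e e0; have e2 : 0 < e / 2 by rewrite divr_gt0.
have := uc _ e2 _ e2; apply: filterS => x ux; lra.
Qed.

Lemma lsup_shift (u : R -> R) (s c : R) : lsup u c -> lsup (fun x => u (x + s)) c.
Proof.
move=> uc e e0; have [A [Ar uA]] := uc e e0.
exists (A - s); split; first exact: num_real.
by move=> x Ax; apply: uA; rewrite -ltrBlDr.
Qed.

(** The excess of [|u|] over [c] is bounded and tends to 0, so dominated convergence removes its
    contribution; what remains of [|u|] is at most [c]. *)
Lemma lsup_cv u M r c : bm u M -> integ r -> 0 <= c -> lsup u c ->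
  lsup (cv u r) (c * \int[mu]_t `|r t|).
Proof.
move=> bu ri c0 uc; have [mu_ uM] := bu; have M0 := bm_ge0 bu.
pose F s y := Num.max (`|u (s - y)| - c) 0 * `|r y|.
have bF s : bm (fun y => Num.max (`|u (s - y)| - c) 0) M.
  have [ms _] := bm_refl s bu; split.
    apply: measurable_maxr => //; apply: measurable_funB => //.
    exact: measurableT_comp.
  move=> y; rewrite ger0_norm ?le_max ?lexx ?orbT//.
  rewrite ge_max M0 andbT (le_trans _ (uM (s - y)))//.
  by rewrite lerBlDr lerDl.
have rni := integ_norm ri.
have F0 : \int[mu]_y F s y @[s --> +oo] --> \int[mu]_y (0 : R).
  apply: (@dct_pinfty _ F (fun=> 0) (fun y => M * `|r y|)).
  - by move=> s; have [mF FM] := bF s; exact: integ_meas (integ_bM mF FM rni).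
  - exact: integZ.
  - move=> s y; have [_ FM] := bF s; rewrite normrM normr_id.
    by rewrite ler_wpM2r.
  - move=> y; apply/cvgr0Pnorm_le => e e0.
    have e1 : 0 < e / (`|r y| + 1) by rewrite divr_gt0// ltr_wpDl.
    have := lsup_shift (- y) uc e1; apply: filterS => s us.
    have [_ FM] := bF s; rewrite /F normrM normr_id.
    apply: (@le_trans _ _ (e / (`|r y| + 1) * `|r y|)).
      rewrite ler_wpM2r// ger0_norm ?le_max ?lexx ?orbT//.
      by rewrite ge_max (ltW e1) andbT lerBlDl.
    rewrite mulrAC ler_pdivrMr ?ltr_wpDl// ler_wpM2l ?ltW//.
    by rewrite ltrDl.
rewrite Rintegral_cst// mul0r in F0.
move=> e e0; move/cvgr0Pnorm_le : F0 => /(_ _ e0); apply: filterS => s Fs.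
have [mF FM] := bF s; have Fi := integ_bM mF FM rni.
apply: (@le_trans _ _ (\int[mu]_t (c * `|r t| + F s t))).
  apply: Rint_norm_le.
  - exact: integ_meas (integ_cv s bu ri).
  - by apply: integD => //; exact: integZ.
  - move=> t; rewrite normrM /F -mulrDl ler_wpM2r//.
    by rewrite -lerBlDl le_max lexx.
rewrite RintegralD//; last exact: integZ.
rewrite RintegralZl// lerD2l.
exact: le_trans (ler_norm _) Fs.
Qed.

End LimsupBound.

(** * Cosine and sine transforms, and their convolution theorem *)

Section TrigTransforms.
Context {R : realType}.
Local Notation mu := (@lebesgue_measure R).

(** The transforms play two roles: for a kernel they are the real part and the negated imaginary
    part of its Fourier transform, and for a profile they synthesize the kernel that has it. *)
Definition cosT (f : R -> R) (x : R) : R := \int[mu]_y (f y * cos (x * y)).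
Definition sinT (f : R -> R) (x : R) : R := \int[mu]_y (f y * sin (x * y)).

Lemma measurable_cos : measurable_fun [set: R] (@cos R).
Proof. by apply: continuous_measurable_fun; exact: continuous_cos. Qed.

Lemma measurable_sin : measurable_fun [set: R] (@sin R).
Proof. by apply: continuous_measurable_fun; exact: continuous_sin. Qed.

Lemma bm_cosM (x : R) : bm (fun y : R => cos (x * y)) 1.
Proof.
split; last by move=> y; exact: cos_max.
by apply: (measurableT_comp measurable_cos); exact: measurable_funM.
Qed.

Lemma bm_sinM (x : R) : bm (fun y : R => sin (x * y)) 1.
Proof.
split; last by move=> y; exact: sin_max.
by apply: (measurableT_comp measurable_sin); exact: measurable_funM.
Qed.

Lemma integ_Mbm (f u : R -> R) M : integ f -> bm u M -> integ (fun y => f y * u y).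
Proof.
move=> fi [mu_ uM]; have := integ_bM mu_ uM fi.
by congr (mu.-integrable _ _); apply/funext => y /=; rewrite mulrC.
Qed.

Lemma integ_cosM f (x : R) : integ f -> integ (fun y => f y * cos (x * y)).
Proof. by move=> fi; exact: integ_Mbm fi (bm_cosM x). Qed.

Lemma integ_sinM f (x : R) : integ f -> integ (fun y => f y * sin (x * y)).
Proof. by move=> fi; exact: integ_Mbm fi (bm_sinM x). Qed.

Lemma norm_cosT_le f x : integ f -> `|cosT f x| <= \int[mu]_y `|f y|.
Proof.
move=> fi; apply: Rint_norm_le; first exact: integ_meas (integ_cosM x fi).
  exact: integ_norm.
by move=> y; rewrite normrM ler_piMr// cos_max.
Qed.

Lemma norm_sinT_le f x : integ f -> `|sinT f x| <= \int[mu]_y `|f y|.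
Proof.
move=> fi; apply: Rint_norm_le; first exact: integ_meas (integ_sinM x fi).
  exact: integ_norm.
by move=> y; rewrite normrM ler_piMr// sin_max.
Qed.

Lemma continuous_cosT f : integ f -> continuous (cosT f).
Proof.
move=> fi x; apply/(@cvg_nbhsP _ R^o) => u ux.
apply: (@dct _ (fun n y => f y * cos (u n * y)) _ (fun y => `|f y|)).
- by move=> n; exact: integ_meas (integ_cosM _ fi).
- exact: integ_norm.
- by move=> n y; rewrite normrM ler_piMr// cos_max.
- move=> y; apply: cvgMr.
  apply: continuous_cvg; first exact: continuous_cos.
  exact: cvgMl.
Qed.

Lemma continuous_sinT f : integ f -> continuous (sinT f).
Proof.
move=> fi x; apply/(@cvg_nbhsP _ R^o) => u ux.
apply: (@dct _ (fun n y => f y * sin (u n * y)) _ (fun y => `|f y|)).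
- by move=> n; exact: integ_meas (integ_sinM _ fi).
- exact: integ_norm.
- by move=> n y; rewrite normrM ler_piMr// sin_max.
- move=> y; apply: cvgMr.
  apply: continuous_cvg; first exact: continuous_sin.
  exact: cvgMl.
Qed.

Lemma cosTD f g x : integ f -> integ g ->
  cosT (fun y => f y + g y) x = cosT f x + cosT g x.
Proof.
move=> fi gi; rewrite /cosT -RintegralD//; [|exact: integ_cosM..].
by apply: eq_Rint => y; rewrite mulrDl.
Qed.

Lemma cosTN f x : integ f -> cosT (fun y => (-1) * f y) x = - cosT f x.
Proof.
move=> fi; rewrite -[RHS]mulN1r /cosT -RintegralZl//; last exact: integ_cosM.
by apply: eq_Rint => y; rewrite mulrA.
Qed.

Lemma sinTN f x : integ f -> sinT (fun y => (-1) * f y) x = - sinT f x.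
Proof.
move=> fi; rewrite -[RHS]mulN1r /sinT -RintegralZl//; last exact: integ_sinM.
by apply: eq_Rint => y; rewrite mulrA.
Qed.

Lemma bm_cosT f : integ f -> bm (cosT f) (\int[mu]_y `|f y|).
Proof.
move=> fi; split; last by move=> x; exact: norm_cosT_le.
by apply: continuous_measurable_fun; exact: continuous_cosT.
Qed.

Lemma bm_sinT f : integ f -> bm (sinT f) (\int[mu]_y `|f y|).
Proof.
move=> fi; split; last by move=> x; exact: norm_sinT_le.
by apply: continuous_measurable_fun; exact: continuous_sinT.
Qed.

(** A synthesized kernel is a superposition of oscillations with weights [A y], and [q] acts on each
    frequency separately. Stated for any bounded [tr], it covers the cosine, the sine and, at
    [x = 0], pairings of kernels. *)
Lemma cv_trig_fubini A q (tr : R -> R) x : (forall y, `|tr y| <= 1) ->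
  measurable_fun [set: R] tr -> integ A -> integ q ->
  \int[mu]_t ((\int[mu]_y (A y * tr ((x - t) * y))) * q t) =
  \int[mu]_y (A y * \int[mu]_t (q t * tr ((x - t) * y))).
Proof.
move=> tr1 mtr Ai qi.
have mtr2 : measurable_fun [set: R * R] (fun z => tr ((x - z.1) * z.2)).
  apply: (measurableT_comp mtr); apply: measurable_funM => //.
  exact: measurable_funB.
have btr1 t : bm (fun y => tr ((x - t) * y)) 1.
  by split=> // ; apply: (measurableT_comp mtr); exact: measurable_funM.
have btr2 y : bm (fun t => tr ((x - t) * y)) 1.
  split=> // ; apply: (measurableT_comp mtr); apply: measurable_funM => //.
  exact: measurable_funB.
pose F t y := q t * tr ((x - t) * y) * A y.
transitivity (\int[mu]_t \int[mu]_y F t y).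
  apply: eq_Rint => t; rewrite -RintegralZr//; last exact: integ_Mbm Ai (btr1 t).
  by apply: eq_Rint => y; rewrite /F; ring.
have iF1 y : integ (fun t => F t y).
  have := integZ (A y) (integ_Mbm qi (btr2 y)).
  by congr (mu.-integrable _ _); apply/funext => t /=; rewrite mulrC.
transitivity (\int[mu]_y \int[mu]_t F t y); last first.
  apply: eq_Rint => y; rewrite mulrC -RintegralZr//.
  exact: integ_Mbm qi (btr2 y).
apply: (@Rfubini _ F (fun y => (\int[mu]_t `|q t|) * `|A y|)) => //.
- apply: measurable_funM; last exact: (measurableT_comp (integ_meas Ai)).
  by apply: measurable_funM => //; exact: (measurableT_comp (integ_meas qi)).
- move=> t; have := integZ (q t) (integ_Mbm Ai (btr1 t)).
  congr (mu.-integrable _ _); apply/funext => y /=; congr EFin; rewrite /F; ring.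
- by apply: integZ; exact: integ_norm.
- move=> y; rewrite -RintegralZr//; last exact: integ_norm.
  apply: Rint_le; first exact: integ_norm.
  + have := integZ (`|A y|) (integ_norm qi).
    by congr (mu.-integrable _ _); apply/funext => t /=; rewrite mulrC.
  + by move=> t; rewrite /F !normrM ler_wpM2r// ler_piMr.
Qed.

(** Expanding [cos (x * y - t * y)] separates [x] from [t]. The odd part of [q] turns cosines into
    sines, so that one convolution alone leaves the class of cosine transforms. *)
Lemma cv_cosT A q x : integ A -> integ q -> cv (cosT A) q x =
  cosT (fun y => A y * cosT q y) x + sinT (fun y => A y * sinT q y) x.
Proof.
move=> Ai qi; have bc := bm_cosT qi; have bs := bm_sinT qi.
rewrite /cv (@cv_trig_fubini A q cos)//; last 2 first.
  exact: cos_max.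
  exact: measurable_cos.
rewrite /cosT /sinT -RintegralD//; last 2 first.
  exact: integ_cosM (integ_Mbm Ai bc).
  exact: integ_sinM (integ_Mbm Ai bs).
apply: eq_Rint => y; rewrite -!mulrA -mulrDr; congr (_ * _).
rewrite -RintegralZr//; last exact: integ_cosM.
rewrite -RintegralZr//; last exact: integ_sinM.
rewrite -RintegralD//; last 2 first.
  by apply: (integ_Mbm (u := fun=> cos (x * y)) (integ_cosM y qi)); split=> // z; exact: cos_max.
  by apply: (integ_Mbm (u := fun=> sin (x * y)) (integ_sinM y qi)); split=> // z; exact: sin_max.
apply: eq_Rint => t; rewrite mulrBl cosB (mulrC t y); ring.
Qed.

Lemma cv_sinT A q x : integ A -> integ q -> cv (sinT A) q x =
  sinT (fun y => A y * cosT q y) x - cosT (fun y => A y * sinT q y) x.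
Proof.
move=> Ai qi; have bc := bm_cosT qi; have bs := bm_sinT qi.
rewrite /cv (@cv_trig_fubini A q sin)//; last 2 first.
  exact: sin_max.
  exact: measurable_sin.
rewrite /cosT /sinT -RintegralB//; last 2 first.
  exact: integ_sinM (integ_Mbm Ai bc).
  exact: integ_cosM (integ_Mbm Ai bs).
apply: eq_Rint => y; rewrite -!mulrA -mulrBr; congr (_ * _).
rewrite -RintegralZr//; last exact: integ_cosM.
rewrite -RintegralZr//; last exact: integ_sinM.
rewrite -RintegralB//; last 2 first.
  by apply: (integ_Mbm (u := fun=> sin (x * y)) (integ_cosM y qi)); split=> // z; exact: sin_max.
  by apply: (integ_Mbm (u := fun=> cos (x * y)) (integ_sinM y qi)); split=> // z; exact: cos_max.
apply: eq_Rint => t; rewrite mulrBl sinB (mulrC t y); ring.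
Qed.

Definition reflect_fun (f : R -> R) : R -> R := fun x => f (- x).

Lemma integ_reflect f : integ f -> integ (reflect_fun f).
Proof.
move=> /(integ_refl 0).
by congr (mu.-integrable _ _); apply/funext => x /=; rewrite sub0r.
Qed.

Lemma Rint_reflect f : integ f -> \int[mu]_x f (- x) = \int[mu]_x f x.
Proof. by move=> /(Rint_refl 0) <-; apply: eq_Rint => x; rewrite sub0r. Qed.

Lemma cosT_reflect f x : integ f -> cosT (reflect_fun f) x = cosT f x.
Proof.
move=> fi; rewrite /cosT -Rint_reflect.
  by apply: eq_Rint => y; rewrite /reflect_fun opprK mulrN cosN.
exact: integ_cosM (integ_reflect fi).
Qed.

Lemma sinT_reflect f x : integ f -> sinT (reflect_fun f) x = - sinT f x.
Proof.
move=> fi; rewrite /sinT -Rint_reflect; last exact: integ_sinM (integ_reflect fi).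
rewrite -mulN1r -RintegralZl//; last exact: integ_sinM.
by apply: eq_Rint => y; rewrite /reflect_fun opprK mulrN sinN mulN1r mulrN.
Qed.

(* Convolving with [q] and its reflection multiplies the transform by the
   squared modulus of the Fourier transform of [q]. *)
Definition power (q : R -> R) (y : R) : R := cosT q y ^+ 2 + sinT q y ^+ 2.

Lemma cv_cosT_power A q x : integ A -> integ q ->
  cv (cv (cosT A) q) (reflect_fun q) x = cosT (fun y => A y * power q y) x.
Proof.
move=> Ai qi; have bc := bm_cosT qi; have bs := bm_sinT qi.
have ri := integ_reflect qi.
have Aci := integ_Mbm Ai bc; have Asi := integ_Mbm Ai bs.
have -> : cv (cosT A) q = (fun x => cosT (fun y => A y * cosT q y) x -
    (- sinT (fun y => A y * sinT q y) x)).
  by apply/funext => z; rewrite opprK cv_cosT.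
have bAc := bm_cosT Aci; have bAs := bm_sinT Asi.
have bNAs : bm (fun x => - sinT (fun y => A y * sinT q y) x)
   (\int[mu]_y `|A y * sinT q y|).
  split; first by apply: measurableT_comp => //; exact: bAs.1.
  by move=> z; rewrite normrN; exact: bAs.2.
rewrite (cvBl _ bAc bNAs)// cv_cosT//.
rewrite (_ : cv (fun _ => _) _ x =
    - cv (sinT (fun y => A y * sinT q y)) (reflect_fun q) x); last first.
  rewrite -mulN1r /cv -RintegralZl//; last exact: integ_cv bAs ri.
  by apply: eq_Rint => t; rewrite mulN1r mulNr.
rewrite opprK cv_sinT//.
have e1 : (fun y => A y * cosT q y * cosT (reflect_fun q) y) =
  (fun y => A y * cosT q y * cosT q y).
  by apply/funext => y; rewrite cosT_reflect.
have e2 : (fun y => A y * cosT q y * sinT (reflect_fun q) y) =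
  (fun y => (-1) * (A y * cosT q y * sinT q y)).
  by apply/funext => y; rewrite sinT_reflect// mulrN mulN1r.
have e3 : (fun y => A y * sinT q y * cosT (reflect_fun q) y) =
  (fun y => A y * cosT q y * sinT q y).
  by apply/funext => y; rewrite cosT_reflect// mulrAC.
have e4 : (fun y => A y * sinT q y * sinT (reflect_fun q) y) =
  (fun y => (-1) * (A y * sinT q y * sinT q y)).
  by apply/funext => y; rewrite sinT_reflect// mulrN mulN1r.
rewrite e1 e2 e3 e4.
have i1 := integ_Mbm Aci bc; have i2 := integ_Mbm Aci bs.
have i4 := integ_Mbm Asi bs.
(* Reflection changes the sign of [sinT q] only, so the two mixed terms with [cosT q * sinT q]
   cancel and the squares add up. *)
rewrite sinTN// cosTN// opprK addrA subrK -cosTD//.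
by congr cosT; apply/funext => y; rewrite /power; ring.
Qed.

(** The constant 4 comes from two differences of squares, each at most [e] times a sum of two terms
    bounded by the L1 norm of [f]. *)
Lemma powerB q f (e : R) y : integ q -> integ f ->
  \int[mu]_t `|q t| <= \int[mu]_t `|f t| ->
  \int[mu]_t `|f t - q t| <= e ->
  power f y - 4 * e * \int[mu]_t `|f t| <= power q y.
Proof.
move=> qi fi qf fqe.
have H (a b E N : R) : `|a - b| <= E -> `|a| <= N -> `|b| <= N ->
  a ^+ 2 - 2 * E * N <= b ^+ 2.
  move=> ab aN bN.
  have : `|(a - b) * (a + b)| <= E * (2 * N).
    rewrite normrM ler_pM//; apply: (le_trans (ler_normD _ _)); lra.
  rewrite ler_norml => /andP[h1 h2]; nra.
have c := H (cosT f y) (cosT q y) e (\int[mu]_t `|f t|).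
have s := H (sinT f y) (sinT q y) e (\int[mu]_t `|f t|).
have fqi := integB fi qi.
have Ec : cosT f y - cosT q y = cosT (fun t => f t - q t) y.
  rewrite /cosT -RintegralB//; [|exact: integ_cosM..].
  by apply: eq_Rint => t; rewrite mulrBl.
have Es : sinT f y - sinT q y = sinT (fun t => f t - q t) y.
  rewrite /sinT -RintegralB//; [|exact: integ_sinM..].
  by apply: eq_Rint => t; rewrite mulrBl.
rewrite Ec in c; rewrite Es in s.
have := c (le_trans (norm_cosT_le y fqi) fqe) (norm_cosT_le y fi)
  (le_trans (norm_cosT_le y qi) qf).
have := s (le_trans (norm_sinT_le y fqi) fqe) (norm_sinT_le y fi)
  (le_trans (norm_sinT_le y qi) qf).
rewrite /power; lra.
Qed.

End TrigTransforms.

(** * Differentiation rules, C^2 profiles and the decay of their cosine transforms *)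

Section SmoothKernels.
Context {R : realType}.
Local Notation mu := (@lebesgue_measure R).

Lemma is_derM (f g : R -> R) (x df dg : R) :
  is_derive x 1 f df -> is_derive x 1 g dg ->
  is_derive x 1 (fun y => f y * g y) (df * g x + f x * dg).
Proof.
move=> Df Dg; apply: (is_derive_eq (is_deriveM Df Dg)).
by rewrite addrC /GRing.scale/= [g x * df]mulrC.
Qed.

Lemma is_derD (f g : R -> R) (x df dg : R) :
  is_derive x 1 f df -> is_derive x 1 g dg ->
  is_derive x 1 (fun y => f y + g y) (df + dg).
Proof. by move=> Df Dg; exact: is_deriveD Df Dg. Qed.

Lemma is_derB (f g : R -> R) (x df dg : R) :
  is_derive x 1 f df -> is_derive x 1 g dg ->
  is_derive x 1 (fun y => f y - g y) (df - dg).
Proof. by move=> Df Dg; exact: is_deriveB Df Dg. Qed.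

Lemma is_derZ (k : R) (f : R -> R) (x df : R) :
  is_derive x 1 f df -> is_derive x 1 (fun y => k * f y) (k * df).
Proof. by move=> Df; exact: is_deriveZ Df. Qed.

Lemma is_derV (f : R -> R) (x df : R) : f x != 0 ->
  is_derive x 1 f df -> is_derive x 1 (fun y => (f y)^-1) (- (f x ^- 2 * df)).
Proof.
by move=> fx Df; apply: (is_derive_eq (is_deriveV fx Df)); rewrite scaleNr.
Qed.

Lemma is_der_cvg (f : R -> R) (x df : R) :
  is_derive x 1 f df -> {for x, continuous f}.
Proof. by move=> [Df _]; exact/differentiable_continuous/derivable1_diffP. Qed.

Section Primitive.
Variables (a b : R) (F f : R -> R).
Hypothesis dF : forall x, x \in `[a, b] -> is_derive x 1 F (f x).

Lemma is_der_oo : a < b ->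
  derivable_oo_LRcontinuous F a b /\ {in `]a, b[, F^`()%classic =1 f}.
Proof.
move=> ab; split; first split.
- move=> x xab; have xab' : x \in `[a, b] by exact: subset_itv_oo_cc.
  by have [] := dF xab'.
- apply: cvg_at_right_filter; have aab : a \in `[a, b] by rewrite in_itv/= lexx ltW.
  exact: is_der_cvg (dF aab).
- apply: cvg_at_left_filter; have bab : b \in `[a, b] by rewrite in_itv/= lexx ltW.
  exact: is_der_cvg (dF bab).
- move=> x xab; have xab' : x \in `[a, b] by exact: subset_itv_oo_cc.
  by rewrite derive1E; have [_ ->] := dF xab'.
Qed.

Lemma is_der_within : {within `[a, b], continuous F}.
Proof. by apply: derivable_within_continuous => x xab; have [] := dF xab. Qed.

End Primitive.

Lemma within_continuous_at (f : R -> R) (a b : R) :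
  (forall x, x \in `[a, b] -> {for x, continuous f}) ->
  {within `[a, b], continuous f}.
Proof.
move=> cf; apply: continuous_in_subspaceT => x; rewrite inE/= => xab.
exact: cf.
Qed.

Lemma within_itv_integ (f : R -> R) (a b : R) : {within `[a, b], continuous f} ->
  integ (f \_ `[a, b]).
Proof.
move=> cf; rewrite /integ -restrict_EFin.
apply/integrable_restrict => //=; rewrite setTI.
by apply: continuous_compact_integrable => //; exact: segment_compact.
Qed.

Lemma cosT_patch (f : R -> R) (a b x : R) :
  cosT (f \_ `[a, b]) x = \int[mu]_(y in `[a, b]) (f y * cos (x * y)).
Proof.
rewrite Rintegral_mkcond; apply: eq_Rint => y.
by rewrite !patchE; case: ifPn => //; rewrite mul0r.
Qed.

Lemma norm_Rint_itv_le (f : R -> R) (a b B : R) : a <= b ->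
  mu.-integrable `[a, b] (EFin \o f) ->
  (forall x, x \in `[a, b] -> `|f x| <= B) ->
  `|\int[mu]_(y in `[a, b]) f y| <= B * (b - a).
Proof.
move=> ab fi fB; apply: (le_trans (le_normr_Rintegral _ fi)) => //.
apply: (@le_trans _ _ (\int[mu]_(y in `[a, b]) B)).
  apply: le_Rintegral => //; first exact: integrable_norm.
  apply: continuous_compact_integrable; first exact: segment_compact.
  by move=> y; exact: cvg_cst.
rewrite Rintegral_cst//= lebesgue_measure_itv/= lte_fin.
move: ab; rewrite le_eqVlt => /predU1P[->|->//].
by rewrite ltxx subrr.
Qed.

(* [L] sets the scale at which derivatives are measured: the least [B] for
   large [L] is close to the sup norm of [A], yet it is submultiplicative up to a
   factor 4. *)
Definition C2 (a b L B : R) (A A1 A2 : R -> R) : Prop :=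
  forall x, x \in `[a, b] ->
  [/\ is_derive x 1 A (A1 x), is_derive x 1 A1 (A2 x), {for x, continuous A2}
    & [/\ `|A x| <= B, `|A1 x| <= L * B & `|A2 x| <= L ^+ 2 * B]].

(** The factor 4 counts the terms of the second derivative of a product, each at most
    [L ^+ 2 * (B * B')]; the function and its first derivative have fewer terms. *)
Lemma C2M a b L B B' A A1 A2 S S1 S2 : 0 <= L ->
  C2 a b L B A A1 A2 -> C2 a b L B' S S1 S2 ->
  C2 a b L (4 * (B * B')) (fun x => A x * S x)
    (fun x => A1 x * S x + A x * S1 x)
    (fun x => A2 x * S x + A1 x * S1 x + (A1 x * S1 x + A x * S2 x)).
Proof.
move=> L0 CA CS x xab.
have [dA dA1 cA2 [A0 A1b A2b]] := CA x xab.
have [dS dS1 cS2 [S0 S1b S2b]] := CS x xab.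
have B0 := le_trans (normr_ge0 _) A0; have B'0 := le_trans (normr_ge0 _) S0.
have M (u v U V : R) : `|u| <= U -> `|v| <= V -> `|u * v| <= U * V.
  by move=> uU vV; rewrite normrM ler_pM.
split.
- exact: is_derM.
- by apply: is_derD; exact: is_derM.
- have cA := is_der_cvg dA; have cS := is_der_cvg dS.
  have cA1 := is_der_cvg dA1; have cS1 := is_der_cvg dS1.
  by apply: cvgD; apply: cvgD; apply: cvgM.
- have BB : 0 <= B * B' by rewrite mulr_ge0.
  have LBB : 0 <= L * (B * B') by rewrite mulr_ge0.
  have LLBB : 0 <= L ^+ 2 * (B * B') by rewrite mulr_ge0// sqr_ge0.
  split.
  + by apply: (le_trans (M _ _ _ _ A0 S0)); lra.
  + apply: (le_trans (ler_normD _ _)).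
    have := M _ _ _ _ A1b S0; have := M _ _ _ _ A0 S1b; nra.
  + apply: (le_trans (ler_normD _ _)).
    have := ler_normD (A2 x * S x) (A1 x * S1 x).
    have := ler_normD (A1 x * S1 x) (A x * S2 x).
    have := M _ _ _ _ A2b S0; have := M _ _ _ _ A0 S2b.
    have := M _ _ _ _ A1b S1b.
    rewrite (_ : L * B * (L * B') = L ^+ 2 * (B * B')); last by ring.
    rewrite (_ : L ^+ 2 * B * B' = L ^+ 2 * (B * B')); last by ring.
    rewrite (_ : B * (L ^+ 2 * B') = L ^+ 2 * (B * B')); last by ring.
    lra.
Qed.

Lemma C2_continuous a b L B A A1 A2 : C2 a b L B A A1 A2 ->
  {within `[a, b], continuous A}.
Proof. by move=> CA; apply: (is_der_within (f := A1)) => x /CA[]. Qed.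

(** Two integrations by parts bound [x ^+ 2] times the transform, and the trivial bound is added to
    reach [1 + x ^+ 2]. The first boundary term at [a] is [A a * sin (x * a)], whence the
    alternative [a = 0]: a profile on [[0, b]] may be nonzero at 0, provided it is flat there. *)
Lemma cosT_decay a b L B A A1 A2 x : 0 <= a -> a < b -> 0 <= L -> C2 a b L B A A1 A2 ->
  A b = 0 -> A1 b = 0 -> A1 a = 0 -> (A a = 0 \/ a = 0) ->
  `|cosT (A \_ `[a, b]) x| <= (1 + L ^+ 2) * B * (b - a) / (1 + x ^+ 2).
Proof.
move=> a0 ab L0 CA Ab A1b A1a Aa.
have aab : a \in `[a, b] by rewrite in_itv/= lexx ltW.
have B0 : 0 <= B by have [_ _ _ [+ _ _]] := CA a aab; exact: le_trans.
have dcos (y : R) : is_derive y 1 (fun y => cos (x * y)) (- (x * sin (x * y))).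
  have := is_derive1_comp (is_derive_cos (x * y)) (is_derZ x (is_derive_id y 1)).
  by rewrite mulr1 mulNr mulrC.
have dsin (y : R) : is_derive y 1 (fun y => sin (x * y)) (x * cos (x * y)).
  have := is_derive1_comp (is_derive_sin (x * y)) (is_derZ x (is_derive_id y 1)).
  by rewrite mulr1 mulrC.
have cc : {within `[a, b], continuous (fun y => cos (x * y))}.
  by apply: within_continuous_at => y _; exact: is_der_cvg (dcos y).
have cs : {within `[a, b], continuous (fun y => sin (x * y))}.
  by apply: within_continuous_at => y _; exact: is_der_cvg (dsin y).
have cA := C2_continuous CA.
have cA1 : {within `[a, b], continuous A1}.
  by apply: (is_der_within (f := A2)) => y /CA[].
have cA2 : {within `[a, b], continuous A2}.
  by apply: within_continuous_at => y /CA[].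
have icont (u v : R -> R) : {within `[a, b], continuous u} -> {within `[a, b], continuous v} ->
    mu.-integrable `[a, b] (EFin \o (fun y => u y * v y)).
  move=> cu cv'; apply: continuous_compact_integrable; first exact: segment_compact.
  by move=> y; apply: cvgM; [exact: cu|exact: cv'].
have bnd0 : `|cosT (A \_ `[a, b]) x| <= B * (b - a).
  rewrite cosT_patch; apply: norm_Rint_itv_le; [exact: ltW|exact: icont|].
  move=> y /CA[_ _ _ [Ay _ _]]; rewrite normrM -[leRHS]mulr1 ler_pM// cos_max//.
have bnd2 : x ^+ 2 * `|cosT (A \_ `[a, b]) x| <= L ^+ 2 * B * (b - a).
  have IBP1 : x * cosT (A \_ `[a, b]) x = - \int[mu]_(y in `[a, b]) (A1 y * sin (x * y)).
    have [Ao Ad] := is_der_oo (fun y yab => let: And4 p _ _ _ := CA y yab in p) ab.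
    have [so sd] := is_der_oo (fun y _ => dsin y) ab.
    have cxc : {within `[a, b], continuous (fun y => x * cos (x * y))}.
      by move=> y; apply: cvgM; [exact: cvg_cst|exact: cc].
    have := Rintegration_by_parts ab cA1 Ao Ad cxc so sd.
    rewrite Ab mul0r (_ : A a * sin (x * a) = 0) ?subrr ?sub0r; last first.
      by case: Aa => ->; rewrite ?mul0r// mulr0 sin0 mulr0.
    move=> <-; rewrite cosT_patch -RintegralZl//; last exact: icont.
    by apply: eq_Rintegral => y _; rewrite mulrCA.
  have IBP2 : x * \int[mu]_(y in `[a, b]) (A1 y * sin (x * y)) =
      \int[mu]_(y in `[a, b]) (A2 y * cos (x * y)).
    have [Ao Ad] := is_der_oo (fun y yab => let: And4 _ p _ _ := CA y yab in p) ab.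
    have [so sd] := is_der_oo (fun y _ => dcos y) ab.
    have cxc : {within `[a, b], continuous (fun y => - (x * sin (x * y)))}.
      by move=> y; apply: cvgN; apply: cvgM; [exact: cvg_cst|exact: cs].
    have := Rintegration_by_parts ab cA2 Ao Ad cxc so sd.
    rewrite A1b A1a !mul0r subrr sub0r => /(congr1 -%R); rewrite opprK => <-.
    rewrite -RintegralZl//; last exact: icont.
    rewrite -mulN1r -RintegralZl//; last exact: icont.
    by apply: eq_Rintegral => y _; ring.
  have <- : `|\int[mu]_(y in `[a, b]) (A2 y * cos (x * y))| = x ^+ 2 * `|cosT (A \_ `[a, b]) x|.
    by rewrite -IBP2 -normrN -mulrN -IBP1 mulrA -expr2 normrM (ger0_norm (sqr_ge0 x)).
  apply: norm_Rint_itv_le; [exact: ltW|exact: icont|].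
  move=> y /CA[_ _ _ [_ _ Ay]]; rewrite normrM -[leRHS]mulr1 ler_pM// cos_max//.
rewrite ler_pdivlMr; last by rewrite ltr_pwDl// sqr_ge0.
rewrite mulrDr mulr1 -[(1 + _) * _ * _]mulrA mulrDl mul1r [`|_| * _]mulrC.
by apply: lerD => //; rewrite mulrA.
Qed.

End SmoothKernels.

(** * Smoothness of transforms, and truncation of kernels *)

Section DerivativesOfTransforms.
Context {R : realType}.
Local Notation mu := (@lebesgue_measure R).

(** Differentiation under the integral sign, dominated by [|y * q y|]. *)
Lemma is_der_under (tr dtr q : R -> R) (x : R) :
  (forall z : R, is_derive z 1 tr (dtr z)) -> (forall z, `|tr z| <= 1) ->
  (forall z, `|dtr z| <= 1) -> integ q -> integ (fun y => y * q y) ->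
  is_derive x 1 (fun x => \int[mu]_y (q y * tr (x * y)))
    (\int[mu]_y (y * q y * dtr (x * y))).
Proof.
move=> dT T1 dT1 qi yqi.
have mtr : measurable_fun [set: R] tr.
  by apply: continuous_measurable_fun => z; exact: is_der_cvg (dT z).
have dF (z y : R) : is_derive z 1 (fun z => q y * tr (z * y)) (y * q y * dtr (z * y)).
  have H : is_derive z 1 (fun z => z * y) y.
    have := is_derM (is_derive_id z 1) (is_derive_cst y z 1).
    by rewrite mul1r mulr0 addr0.
  have := is_derZ (q y) (@is_derive1_comp _ tr (fun z => z * y) z _ _ (dT (z * y)) H).
  by move=> D; apply: (is_derive_eq D); ring.
have pE (z y : R) : partial1of2 (fun z y => q y * tr (z * y)) z y =
    y * q y * dtr (z * y).
  by rewrite partial1of2E; have [_ ->] := dF z y.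
have xI : `]x - 1, x + 1[%classic x by rewrite /= in_itv/= ltrBlDr ltrDl ltr01.
have intf (z : R) : `]x - 1, x + 1[%classic z ->
    mu.-integrable setT (EFin \o (fun y => q y * tr (z * y))).
  move=> _; apply: (@integ_Mbm _ q (fun y => tr (z * y)) 1) => //.
  by split=> //; apply: (measurableT_comp mtr); exact: measurable_funM.
have derf (z y : R) : `]x - 1, x + 1[%classic z -> [set: R] y ->
    derivable ((fun z y => q y * tr (z * y)) ^~ y) z 1.
  by move=> _ _; have [] := dF z y.
have ub (z y : R) : `]x - 1, x + 1[%classic z -> [set: R] y ->
    `|partial1of2 (fun z y => q y * tr (z * y)) z y| <= `|y * q y|.
  by move=> _ _; rewrite pE normrM ler_piMr.
split.
  exact: (derivable_under_integral measurableT xI intf derf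
     (fun=> normr_ge0 _) (integ_norm yqi) ub).
rewrite -derive1E (differentiation_under_integral measurableT xI intf derf
     (fun=> normr_ge0 _) (integ_norm yqi) ub).
by apply: eq_Rint => y; rewrite pE.
Qed.

Lemma is_der_cosT (q : R -> R) (x : R) : integ q -> integ (fun y => y * q y) ->
  is_derive x 1 (cosT q) (- sinT (fun y => y * q y) x).
Proof.
move=> qi yqi; rewrite -mulN1r -RintegralZl//; last exact: integ_sinM.
have H := @is_der_under cos (fun z => - sin z) q x _ (@cos_max R) _ qi yqi.
apply: is_derive_eq; first apply: H.
  by move=> z; rewrite normrN sin_max.
by apply: eq_Rint => y; rewrite mulN1r mulrN.
Qed.

Lemma is_der_sinT (q : R -> R) (x : R) : integ q -> integ (fun y => y * q y) ->
  is_derive x 1 (sinT q) (cosT (fun y => y * q y) x).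
Proof. by move=> qi yqi; apply: is_der_under => //; [exact: sin_max|exact: cos_max]. Qed.

Definition power1 (q : R -> R) (x : R) : R :=
  2 * (sinT q x * cosT (fun y => y * q y) x - cosT q x * sinT (fun y => y * q y) x).

Definition power2 (q : R -> R) (x : R) : R :=
  2 * (power (fun y => y * q y) x
    - (cosT q x * cosT (fun y => y * (y * q y)) x
       + sinT q x * sinT (fun y => y * (y * q y)) x)).

Lemma is_der_power (q : R -> R) (x : R) : integ q -> integ (fun y => y * q y) ->
  is_derive x 1 (power q) (power1 q x).
Proof.
move=> qi yqi; have dc := is_der_cosT x qi yqi; have ds := is_der_sinT x qi yqi.
have D := is_derD (is_derM dc dc) (is_derM ds ds).
have -> : power q = (fun y => cosT q y * cosT q y + sinT q y * sinT q y).
  by apply/funext => y; rewrite /power !expr2.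
by apply: (is_derive_eq D); rewrite /power1; ring.
Qed.

Lemma is_der_power1 (q : R -> R) (x : R) : integ q -> integ (fun y => y * q y) ->
  integ (fun y => y * (y * q y)) -> is_derive x 1 (power1 q) (power2 q x).
Proof.
move=> qi yqi yyqi; have dc := is_der_cosT x qi yqi; have ds := is_der_sinT x qi yqi.
have dc1 := is_der_cosT x yqi yyqi; have ds1 := is_der_sinT x yqi yyqi.
have := is_derZ 2 (is_derB (is_derM ds dc1) (is_derM dc ds1)).
by move=> D; apply: (is_derive_eq D); rewrite /power2 /power; ring.
Qed.

Lemma continuous_power (q : R -> R) : integ q -> continuous (power q).
Proof.
move=> qi x; have c := @continuous_cosT _ q qi x; have s := @continuous_sinT _ q qi x.
have -> : power q = (fun y => cosT q y * cosT q y + sinT q y * sinT q y).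
  by apply/funext => y; rewrite /power !expr2.
exact: (cvgD (cvgM c c) (cvgM s s)).
Qed.

Lemma continuous_power2 (q : R -> R) : integ q -> integ (fun y => y * q y) ->
  integ (fun y => y * (y * q y)) -> continuous (power2 q).
Proof.
move=> qi yqi yyqi x.
have c := @continuous_cosT _ _ qi x; have s := @continuous_sinT _ _ qi x.
have c2 := @continuous_cosT _ _ yyqi x; have s2 := @continuous_sinT _ _ yyqi x.
have p := @continuous_power _ yqi x.
exact: (cvgM (cvg_cst _) (cvgB p (cvgD (cvgM c c2) (cvgM s s2)))).
Qed.

Lemma itv_bounded (g : R -> R) (a b : R) : a <= b ->
  {within `[a, b], continuous g} ->
  exists2 K, 0 < K & forall x, x \in `[a, b] -> `|g x| <= K.
Proof.
move=> ab cg; have cng : {within `[a, b], continuous (fun x => `|g x|)}.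
  by move=> x; apply: cvg_norm; exact: cg.
have [c _ gc] := EVT_max ab cng; exists (`|g c| + 1); first by rewrite ltr_wpDl.
by move=> x /gc /le_trans; apply; rewrite lerDl.
Qed.

(** A sup bound [B] of [A] is kept as it is, and the size of the derivatives goes into the scale
    alone. Since [L >= 1], having [L >= K2 / B] also settles the condition on [L ^+ 2]. *)
Lemma C2_of_continuous (a b B : R) (A A1 A2 : R -> R) : a <= b -> 0 < B ->
  (forall x, x \in `[a, b] -> [/\ is_derive x 1 A (A1 x), is_derive x 1 A1 (A2 x)
     & {for x, continuous A2}]) ->
  (forall x, x \in `[a, b] -> `|A x| <= B) ->
  exists2 L0, 1 <= L0 & forall L, L0 <= L -> C2 a b L B A A1 A2.
Proof.
move=> ab B0 dA AB.
have [K1 K10 A1K] : exists2 K, 0 < K & forall x, x \in `[a, b] -> `|A1 x| <= K.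
  apply: itv_bounded => //; apply: within_continuous_at => x /dA[_ dA1 _].
  exact: is_der_cvg dA1.
have [K2 K20 A2K] : exists2 K, 0 < K & forall x, x \in `[a, b] -> `|A2 x| <= K.
  by apply: itv_bounded => //; apply: within_continuous_at => x /dA[].
exists (1 + K1 / B + K2 / B).
  by rewrite -addrA lerDl addr_ge0// divr_ge0// ltW.
move=> L L0L x xab; have [d1 d2 c2] := dA x xab.
have k1 : 0 < K1 / B by rewrite divr_gt0.
have k2 : 0 < K2 / B by rewrite divr_gt0.
split=> //; split; first exact: AB.
- apply: (le_trans (A1K x xab)); rewrite -ler_pdivrMr//; lra.
- apply: (le_trans (A2K x xab)); rewrite -ler_pdivrMr//; nra.
Qed.

Lemma C2_weaken (a b L B B' : R) (A A1 A2 : R -> R) : 1 <= L -> 0 <= B ->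
  B <= B' -> C2 a b 1 B A A1 A2 -> C2 a b L B' A A1 A2.
Proof.
move=> L1 B0 BB' CA x xab; have [d1 d2 c2 [b0 b1 b2]] := CA x xab.
split=> //; split; first exact: le_trans BB'.
- by apply: (le_trans b1); rewrite mul1r; nra.
- apply: (le_trans b2); rewrite expr1n mul1r.
  have : 1 <= L ^+ 2 by rewrite exprn_ege1.
  nra.
Qed.

(* Truncating the kernel to a compact support makes its transforms smooth. *)
Definition trunc (f : R -> R) (n : nat) : R -> R := f \_ `[- n%:R, n%:R].

Lemma trunc_le f n y : `|trunc f n y| <= `|f y|.
Proof. by rewrite /trunc patchE; case: ifPn => // _; rewrite normr0. Qed.

Lemma M_trunc_le f n y : `|y * trunc f n y| <= n%:R * `|trunc f n y|.
Proof.
rewrite normrM /trunc patchE; case: ifPn => [|_]; last by rewrite normr0 !mulr0.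
by rewrite inE/= in_itv/= -ler_norml => yn; rewrite ler_wpM2r.
Qed.

Lemma measurable_trunc f n : measurable_fun [set: R] f ->
  measurable_fun [set: R] (trunc f n).
Proof.
move=> mf; apply/(measurable_restrictT _ _).1 => //.
exact: measurable_funS mf.
Qed.

Lemma integ_trunc f n : integ f -> integ (trunc f n).
Proof.
move=> fi; apply: (integ_le (measurable_trunc n (integ_meas fi)) (integ_norm fi)).
exact: trunc_le.
Qed.

Lemma integ_Mtrunc f n : integ f -> integ (fun y => y * trunc f n y).
Proof.
move=> fi; have ti := integ_trunc n fi.
apply: (integ_le _ (integZ n%:R (integ_norm ti))); last exact: M_trunc_le.
by apply: measurable_funM => //; exact: integ_meas.
Qed.

Lemma integ_MMtrunc f n : integ f -> integ (fun y => y * (y * trunc f n y)).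
Proof.
move=> fi; have ti := integ_Mtrunc n fi.
apply: (integ_le _ (integZ n%:R (integ_norm ti))).
  by apply: measurable_funM => //; exact: integ_meas.
move=> y; rewrite normrM /trunc patchE; case: ifPn => [|_]; last by rewrite mulr0 normr0 !mulr0.
by rewrite inE/= in_itv/= -ler_norml => yn; rewrite ler_wpM2r.
Qed.

Lemma trunc_L1_cvg f (e : R) : integ f -> 0 < e ->
  exists n, \int[mu]_y `|f y - trunc f n y| <= e.
Proof.
move=> fi e0.
have : \int[mu]_y `|f y - trunc f n y| @[n --> \oo] --> \int[mu]_y (0 : R).
  apply: (@dct _ _ _ (fun y => 2 * `|f y|)).
  - move=> n; apply: (measurableT_comp (@normr_measurable R setT)).
    apply: measurable_funB; first exact: integ_meas.
    exact: measurable_trunc (integ_meas fi).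
  - exact/integZ/integ_norm.
  - move=> n y; rewrite normr_id (le_trans (ler_normB _ _))//.
    by have := trunc_le f n y; lra.
  - move=> y; apply: cvg_near_cst; near=> n; apply/eqP.
    rewrite normr_eq0 subr_eq0 eq_sym /trunc patchE ifT// inE/= in_itv/= -ler_norml.
    by near: n; exact: nbhs_infty_ger.
rewrite Rintegral_cst// mul0r => /cvgr0Pnorm_le/(_ _ e0)[n _ /(_ n (leqnn n)) h].
by exists n; exact: le_trans (ler_norm _) h.
Unshelve. all: by end_near. Qed.

End DerivativesOfTransforms.

(** * The Tauberian theorem for kernels with spectrum away from the zero of the transform *)

Section LocalTauberian.
Context {R : realType}.
Local Notation mu := (@lebesgue_measure R).

Lemma integ_L1_ge0 (f : R -> R) : 0 <= \int[mu]_t `|f t|.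
Proof. exact: Rintegral_ge0. Qed.

Lemma Rint_norm_reflect (f : R -> R) : integ f ->
  \int[mu]_t `|reflect_fun f t| = \int[mu]_t `|f t|.
Proof. by move=> fi; exact: (Rint_reflect (integ_norm fi)). Qed.

(* Convolving with [f] and its reflection sends [cv p (cosT A)] to a function
   tending to 0, since [cv p f] does; replacing [f] by [q] there costs
   [2 e |f|_1 c] and multiplies the profile [A] by [power q]. *)
Lemma lsup_power p M f q e A c : bm p M -> integ f -> integ q -> integ A ->
  integ (cosT A) -> cv p f x @[x --> +oo] --> 0 ->
  \int[mu]_t `|q t| <= \int[mu]_t `|f t| ->
  \int[mu]_t `|f t - q t| <= e -> 0 <= c ->
  lsup (cv p (cosT A)) c ->
  lsup (cv p (cosT (fun y => A y * power q y))) (2 * e * (\int[mu]_t `|f t|) * c).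
Proof.
move=> bp fi qi Ai ki pf0 qf fqe c0 vc.
pose k := cosT A; pose v := cv p k; pose r t := f t - q t.
have ri : integ r by exact: integB.
have f'i := integ_reflect fi; have r'i := integ_reflect ri.
have q'i := integ_reflect qi.
have bk : bm k (\int[mu]_y `|A y|) by exact: bm_cosT.
have bv := bm_cv bp ki; rewrite -/k -/v in bv.
have N0 := integ_L1_ge0 f; have q0 := integ_L1_ge0 q; have r0 := integ_L1_ge0 r.
have e0 : 0 <= e := le_trans r0 fqe.
(* By commutativity [cv v f] is [cv (cv p f) k], an average of a function tending to 0. *)
have lf : lsup (cv (cv v f) (reflect_fun f)) 0.
  rewrite -[0](mul0r (\int[mu]_t `|reflect_fun f t|)).
  apply: lsup_cv => //; first exact: bm_cv bv fi.
  have -> : cv v f = cv (cv p f) k.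
    by apply/funext => x; exact: cv_comm bp ki fi.
  rewrite -[0](mul0r (\int[mu]_t `|k t|)).
  by apply: lsup_cv => //; [exact: bm_cv bp fi|exact/lsup0P].
have l1 : lsup (cv (cv v q) (reflect_fun r)) (c * (\int[mu]_t `|q t|) * \int[mu]_t `|r t|).
  rewrite -(Rint_norm_reflect ri); apply: lsup_cv => //.
  - exact: bm_cv bv qi.
  - exact: mulr_ge0.
  - exact: lsup_cv bv qi c0 vc.
have l2 : lsup (cv (cv v r) (reflect_fun f)) (c * (\int[mu]_t `|r t|) * \int[mu]_t `|f t|).
  rewrite -(Rint_norm_reflect fi); apply: lsup_cv => //.
  - exact: bm_cv bv ri.
  - exact: mulr_ge0.
  - exact: lsup_cv bv ri c0 vc.
(* With primes for reflections and dots for convolutions, [v.q.q' = v.f.f' - v.q.r' - v.r.f']. Each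
   of the last two terms is asymptotically at most [c * e] times the L1 norm of [f], hence the
   factor 2. *)
have E : cv p (cosT (fun y => A y * power q y)) =
    (fun x => cv (cv v f) (reflect_fun f) x
      - cv (cv v q) (reflect_fun r) x - cv (cv v r) (reflect_fun f) x).
  apply/funext => x.
  have -> : cosT (fun y => A y * power q y) = cv (cv k q) (reflect_fun q).
    by apply/funext => z; rewrite cv_cosT_power.
  have bkq := bm_cv bk qi; have ikq := integ_cvv bk ki qi.
  rewrite -(cv_assoc x bp bkq ikq q'i).
  have -> : cv p (cv k q) = cv v q.
    by apply/funext => z; rewrite -(cv_assoc z bp bk ki qi).
  have bvq := bm_cv bv qi; have bvf := bm_cv bv fi; have bvr := bm_cv bv ri.
  have -> : cv (cv v q) (reflect_fun q) x =
      cv (cv v q) (reflect_fun f) x - cv (cv v q) (reflect_fun r) x.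
    rewrite -(cvBr x bvq f'i r'i); apply: eq_Rint => t; congr (_ * _).
    by rewrite /reflect_fun /r subKr.
  have -> : cv (cv v f) (reflect_fun f) x =
      cv (cv v q) (reflect_fun f) x + cv (cv v r) (reflect_fun f) x.
    apply/eqP; rewrite -subr_eq eq_sym; apply/eqP.
    rewrite -(cvBl x bvf bvr f'i).
    congr (cv _ _ x); apply/funext => z; rewrite -(cvBr z bv fi ri).
    by apply: eq_Rint => t; congr (_ * _); rewrite /r subKr.
  by rewrite [RHS]addrAC addrK.
rewrite E; apply: lsup_le (lsupB (lsupB lf l1) l2).
rewrite add0r.
have h1 : c * (\int[mu]_t `|q t|) * (\int[mu]_t `|r t|) <= c * (\int[mu]_t `|f t|) * e.
  by rewrite ler_pM ?mulr_ge0// ler_wpM2l.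
have h2 : c * (\int[mu]_t `|r t|) * (\int[mu]_t `|f t|) <= c * e * (\int[mu]_t `|f t|).
  by rewrite ler_wpM2r// ler_wpM2l.
apply: (le_trans (lerD h1 h2)).
by rewrite le_eqVlt; apply/orP; left; apply/eqP; ring.
Qed.

Definition oneDsqrV_int : R := \int[mu]_x (1 + x ^+ 2)^-1.

Lemma oneDsqrV_int_ge0 : 0 <= oneDsqrV_int.
Proof. by apply: Rintegral_ge0 => x _; rewrite invr_ge0 addr_ge0 ?sqr_ge0. Qed.

(** The bound is linear in [B], with a factor depending only on [L] and the interval: at a fixed
    scale, L1 norms of kernels grow no faster than the bounds [B] of their profiles. *)
Lemma cosT_C2_L1 a b L B A A1 A2 : 0 <= a -> a < b -> 0 <= L -> C2 a b L B A A1 A2 ->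
  A b = 0 -> A1 b = 0 -> A1 a = 0 -> (A a = 0 \/ a = 0) ->
  integ (cosT (A \_ `[a, b])) /\
  \int[mu]_x `|cosT (A \_ `[a, b]) x| <= (1 + L ^+ 2) * B * (b - a) * oneDsqrV_int.
Proof.
move=> a0 ab L0 CA Ab A1b A1a Aa.
have iA := within_itv_integ (C2_continuous CA).
have Ki := integZ ((1 + L ^+ 2) * B * (b - a)) (@integ_oneDsqrV R).
have le x := cosT_decay x a0 ab L0 CA Ab A1b A1a Aa.
have ic : integ (cosT (A \_ `[a, b])) by apply: (integ_le (bm_cosT iA).1 Ki le).
split => //; rewrite /oneDsqrV_int -RintegralZl//; last exact: integ_oneDsqrV.
by apply: Rint_le => //; exact: integ_norm.
Qed.

Definition inv_der1 (g g1 : R -> R) (x : R) : R := - (g x ^- 2 * g1 x).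

Definition inv_der2 (g g1 g2 : R -> R) (x : R) : R :=
  - (inv_der1 g g1 x * (g x)^-1 * g1 x + (g x)^-1 * inv_der1 g g1 x * g1 x
     + (g x)^-1 * (g x)^-1 * g2 x).

Lemma is_der_inv2 (g g1 g2 : R -> R) (x : R) : g x != 0 ->
  is_derive x 1 g (g1 x) -> is_derive x 1 g1 (g2 x) -> {for x, continuous g2} ->
  [/\ is_derive x 1 (fun y => (g y)^-1) (inv_der1 g g1 x),
      is_derive x 1 (inv_der1 g g1) (inv_der2 g g1 g2 x)
    & {for x, continuous (inv_der2 g g1 g2)}].
Proof.
move=> g0 dg dg1 cg2; have dV := is_derV g0 dg.
have E1 : inv_der1 g g1 = (fun y => -1 * ((g y)^-1 * (g y)^-1 * g1 y)).
  by apply/funext => y; rewrite /inv_der1 mulN1r -exprVn expr2.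
split=> //.
  rewrite E1; apply: (is_derive_eq (is_derZ (-1) (is_derM (is_derM dV dV) dg1))).
  by rewrite mulN1r mulrDl.
have cg1 := is_der_cvg dg1; have cV := is_der_cvg dV.
have c1 : {for x, continuous (inv_der1 g g1)}.
  rewrite E1; exact: (cvgM (cvg_cst _) (cvgM (cvgM cV cV) cg1)).
exact: (cvgN (cvgD (cvgD (cvgM (cvgM c1 cV) cg1) (cvgM (cvgM cV c1) cg1))
  (cvgM (cvgM cV cV) cg2))).
Qed.

(* With [Q = power q], passing from the profile [D / Q^k] down to [D] by
   [lsup_power] gains [(2 e N)^k], whereas the L1 norm of the kernel of
   [D / Q^k] grows only like [(4 rho)^k]. *)
Lemma wiener_local (p f : R -> R) (M a b B : R) (D D1 D2 : R -> R) : bm p M -> integ f ->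
  cv p f x @[x --> +oo] --> 0 -> 0 <= a -> a < b ->
  (forall x, x \in `[a, b] -> 0 < power f x) ->
  C2 a b 1 B D D1 D2 -> D a = 0 -> D b = 0 -> D1 a = 0 -> D1 b = 0 ->
  lsup (cv p (cosT (D \_ `[a, b]))) 0.
Proof.
move=> bp fi pf0 a0 ab fpos CD Da Db D1a D1b.
have aab : a \in `[a, b] by rewrite in_itv/= lexx ltW.
have B0 : 0 <= B by have [_ _ _ [+ _ _]] := CD a aab; exact: le_trans.
have M0 := bm_ge0 bp.
pose N := \int[mu]_t `|f t|; have N0 : 0 <= N := integ_L1_ge0 f.
have [d d0 fd] : exists2 d, 0 < d & forall x, x \in `[a, b] -> d <= power f x.
  have cf : {within `[a, b], continuous (power f)}.
    by apply: within_continuous_at => x _; exact: continuous_power.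
  have [c cab fc] := EVT_min (ltW ab) cf.
  by exists (power f c); first exact: fpos.
(* With this choice [4 * e * N <= d / 4], so that [power q >= 3 / 4 * d] and [rho = 4 / (3 * d)]
   bounds its inverse; and [2 * e * N * (4 * rho) <= d / 8 * (16 / (3 * d)) = 2 / 3]. The [+ 1]
   allows for [N = 0]. *)
pose e := d / (16 * (N + 1)).
have N1 : 0 < N + 1 by rewrite ltr_wpDl.
have e0 : 0 < e by rewrite divr_gt0// mulr_gt0.
have eN : e * N <= d / 16.
  rewrite /e mulrAC ler_pdivrMr ?mulr_gt0// -mulrA (_ : 16^-1 * _ = N + 1); last by field.
  by rewrite ler_wpM2l ?ltW// ltrDl.
have [n fn] := trunc_L1_cvg fi e0.
pose q := trunc f n.
have qi : integ q by exact: integ_trunc.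
have yqi := integ_Mtrunc n fi; have yyqi := integ_MMtrunc n fi.
have qf : \int[mu]_t `|q t| <= N.
  by apply: Rint_le; [exact: integ_norm|exact: integ_norm|move=> t; exact: trunc_le].
have qd x : x \in `[a, b] -> 3 / 4 * d <= power q x.
  move=> /fd fx; have := powerB x qi fi qf fn; rewrite -/N; nra.
have qd0 x : x \in `[a, b] -> 0 < power q x.
  by move=> /qd; apply: lt_le_trans; rewrite mulr_gt0.
pose S x := (power q x)^-1.
pose S1 := inv_der1 (power q) (power1 q).
pose S2 := inv_der2 (power q) (power1 q) (power2 q).
pose rho := 4 / (3 * d).
have rho0 : 0 < rho by rewrite divr_gt0// mulr_gt0.
have eN0 : 0 <= 2 * e * N by apply: mulr_ge0 => //; apply: mulr_ge0 => //; exact: ltW.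
(* This scale depends on [q] but not on the exponent of [S]. The profile [D] is brought to it as
   well, and [L] ends up in the constant [K] only. *)
have [L L11 CS] : exists2 L0, 1 <= L0 & forall L, L0 <= L -> C2 a b L rho S S1 S2.
  apply: C2_of_continuous => //; first exact: ltW.
    move=> x xab; apply: is_der_inv2.
    - by rewrite gt_eqF// qd0.
    - exact: is_der_power.
    - exact: is_der_power1.
    - exact: continuous_power2.
  move=> x xab; rewrite /S ger0_norm; last by rewrite invr_ge0 ltW ?qd0.
  have -> : rho = (3 / 4 * d)^-1 by rewrite /rho -[LHS]invrK invf_div mulrAC.
  by rewrite lef_pV2 ?posrE ?qd0 ?qd// mulr_gt0.
have {}CS := CS L (lexx _); have L0 : 0 <= L by rewrite (le_trans _ L11).
have {}CD := C2_weaken L11 B0 (lexx B) CD.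
pose An k x := D x * S x ^+ k.
(* The product rule gives the derivatives a different shape at each [k], so they are left
   existential. The end values of the first one vanish because those of [D] and [D1] do. *)
have CAn k : exists A1 A2, [/\ C2 a b L (B * (4 * rho) ^+ k) (An k) A1 A2, A1 a = 0 & A1 b = 0].
  elim: k => [|k [A1 [A2 [CA A1a A1b]]]].
    exists D1, D2; split=> //; rewrite expr0 mulr1.
    by rewrite (_ : An 0%N = D)//; apply/funext => x; rewrite /An expr0 mulr1.
  have := C2M L0 CA CS.
  rewrite (_ : (fun x => An k x * S x) = An k.+1); last first.
    by apply/funext => x; rewrite /An exprSr mulrA.
  rewrite (_ : 4 * (B * (4 * rho) ^+ k * rho) = B * (4 * rho) ^+ k.+1); last first.
    by rewrite exprSr; ring.
  move=> CA'; eexists; eexists; split; first exact: CA'.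
    by rewrite /= A1a /An Da !mul0r addr0.
  by rewrite /= A1b /An Db !mul0r addr0.
have step k c : 0 <= c -> lsup (cv p (cosT (An k \_ `[a, b]))) c ->
    lsup (cv p (cosT (D \_ `[a, b]))) ((2 * e * N) ^+ k * c).
  elim: k c => [|k ih] c c0.
    rewrite expr0 mul1r (_ : An 0%N = D)//.
    by apply/funext => x; rewrite /An expr0 mulr1.
  have [A1 [A2 [CA A1a A1b]]] := CAn k.+1.
  have Aka : An k.+1 a = 0 by rewrite /An Da mul0r.
  have Akb : An k.+1 b = 0 by rewrite /An Db mul0r.
  have [ic _] := cosT_C2_L1 a0 ab L0 CA Akb A1b A1a (or_introl Aka).
  have iA := within_itv_integ (C2_continuous CA).
  have EA : (fun y => (An k.+1 \_ `[a, b]) y * power q y) = An k \_ `[a, b].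
    apply/funext => y; rewrite !patchE; case: ifPn => [|_]; last by rewrite mul0r.
    rewrite inE/= => yab; rewrite /An exprSr -!mulrA /S mulVf ?mulr1//.
    by rewrite gt_eqF// qd0.
  move=> /(lsup_power bp fi qi iA ic pf0 qf fn c0); rewrite EA.
  rewrite (_ : _ ^+ k.+1 * c = (2 * e * N) ^+ k * (2 * e * N * c)); last by rewrite exprSr -!mulrA.
  by apply: ih; exact: mulr_ge0.
pose K := M * ((1 + L ^+ 2) * B * (b - a) * oneDsqrV_int).
have main k : lsup (cv p (cosT (D \_ `[a, b]))) (K * (2 / 3) ^+ k).
  have [A1 [A2 [CA A1a A1b]]] := CAn k.
  have Aka : An k a = 0 by rewrite /An Da mul0r.
  have Akb : An k b = 0 by rewrite /An Db mul0r.
  have [ic icL] := cosT_C2_L1 a0 ab L0 CA Akb A1b A1a (or_introl Aka).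
  (* The descent starts from the trivial bound, [M] times the L1 norm of the kernel. *)
  have := lsup_bm (bm_cv bp ic).
  have c0 : 0 <= M * \int[mu]_t `|cosT (An k \_ `[a, b]) t|.
    by rewrite mulr_ge0// integ_L1_ge0.
  move=> /(step k _ c0); apply: lsup_le.
  have h1 : (2 * e * N) ^+ k * (M * \int[mu]_t `|cosT (An k \_ `[a, b]) t|) <=
    (2 * e * N) ^+ k * (M * ((1 + L ^+ 2) * (B * (4 * rho) ^+ k) * (b - a) * oneDsqrV_int)).
    rewrite ler_wpM2l//; last by rewrite ler_wpM2l.
    exact: exprn_ge0.
  apply: (le_trans h1).
  have -> : (2 * e * N) ^+ k * (M * ((1 + L ^+ 2) * (B * (4 * rho) ^+ k) * (b - a) * oneDsqrV_int))
     = K * (2 * e * N * (4 * rho)) ^+ k.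
    by rewrite /K [in RHS]exprMn; ring.
  have K0 : 0 <= K.
    apply: mulr_ge0 => //; apply: mulr_ge0; last exact: oneDsqrV_int_ge0.
    apply: mulr_ge0; last by rewrite subr_ge0 ltW.
    by apply: mulr_ge0 => //; rewrite addr_ge0 ?sqr_ge0.
  rewrite ler_wpM2l// lerXn2r// ?nnegrE ?divr_ge0//.
    by apply: mulr_ge0 => //; apply: mulr_ge0 => //; exact: ltW.
  have -> : 2 * e * N * (4 * rho) = 8 * (e * N) * rho by ring.
  by rewrite /rho [_ * (4 / _)]mulrA ler_pdivrMr ?mulr_gt0//; lra.
apply: lsup_small => s s0; rewrite add0r.
have : K * (2 / 3 : R) ^+ k @[k --> \oo] --> K * 0.
  apply: cvgMr; apply: cvg_expr; rewrite ger0_norm ?divr_ge0//; lra.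
rewrite mulr0 => /cvgr0Pnorm_le/(_ _ s0)[k _ /(_ k (leqnn k))/= ks].
exact: lsup_le (le_trans (ler_norm _) ks) (main k).
Qed.

End LocalTauberian.

(** * The two-sided exponential and its transform *)

Section ExponentialKernel.
Context {R : realType}.
Local Notation mu := (@lebesgue_measure R).

(** Its transform is, up to a constant, the Poisson kernel. It serves as summation factor in
    [splk_int_gt0] and as material for [null_kernel]. *)
Definition expk (a : R) (x : R) : R := expR (- (a * `|x|)).

Lemma expk_ge0 a x : 0 <= expk a x. Proof. exact: expR_ge0. Qed.

Lemma continuous_expk a : continuous (expk a).
Proof.
move=> x; apply: continuous_cvg; first exact: continuous_expR.
by apply: cvgN; apply: cvgM; [exact: cvg_cst|exact: cvg_norm].
Qed.

(** With [t = a * |x| / 2], the exponential of [2 t] is at least [(1 + t) ^+ 2], hence at least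
    [1 + t ^+ 2]. *)
Lemma integ_expk a : 0 < a -> integ (expk a).
Proof.
move=> a0; have a2 : a / 2 != 0 by rewrite gt_eqF// divr_gt0.
apply: (integ_le _ (integ_affine 0 a2 (@integ_oneDsqrV R))).
  by apply: continuous_measurable_fun; exact: continuous_expk.
move=> x; rewrite ger0_norm ?expk_ge0// /expk expRN lef_pV2 ?posrE ?expR_gt0//; last first.
  by rewrite ltr_pwDl// sqr_ge0.
rewrite (_ : a * `|x| = a * `|x| / 2 *+ 2); last by rewrite -mulr_natr; field.
have t0 : 0 <= a * `|x| / 2 by rewrite divr_ge0// mulr_ge0// ltW.
rewrite mulr2n expRD expr2 addr0.
have h := expR_ge1Dx (a * `|x| / 2).
have -> : a / 2 * x * (a / 2 * x) = (a * `|x| / 2) * (a * `|x| / 2).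
  by rewrite -!expr2 !exprMn real_normK ?num_real//; ring.
nra.
Qed.

(** Adding 1 to the cosine makes the integrand nonnegative, as the fundamental theorem on a
    half-line used here requires. Subtracting the contribution of the 1, known from the case
    [xi = 0], then gives the transform. *)
Lemma expk_int1cos a (xi : R) : 0 < a ->
  \int[mu]_x (expk a x * (1 + cos (xi * x))) = 2 / a + 2 * a / (a ^+ 2 + xi ^+ 2).
Proof.
move=> a0; have d0 : 0 < a ^+ 2 + xi ^+ 2 by rewrite ltr_pwDl ?sqr_ge0// exprn_gt0.
pose f (x : R) := expk a x * (1 + cos (xi * x)).
have dlin (k x : R) : is_derive x 1 (fun x => k * x) k.
  by apply: (is_derive_eq (is_derZ k (is_derive_id x 1))); rewrite mulr1.
have dcos (x : R) : is_derive x 1 (fun x => cos (xi * x)) (- sin (xi * x) * xi).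
  exact: (@is_derive1_comp _ cos (fun x => xi * x) x _ _ (is_derive_cos _) (dlin xi x)).
have dsin (x : R) : is_derive x 1 (fun x => sin (xi * x)) (cos (xi * x) * xi).
  exact: (@is_derive1_comp _ sin (fun x => xi * x) x _ _ (is_derive_sin _) (dlin xi x)).
have dexp (x : R) : is_derive x 1 (fun x => expR (- a * x)) (expR (- a * x) * - a).
  exact: (@is_derive1_comp _ expR (fun x => - a * x) x _ _ (is_derive_expR _) (dlin (- a) x)).
(* [expR (- a * x) * u x] is the primitive, on the positive half-line, that vanishes at infinity. *)
pose u (x : R) := - a^-1 + (- a * cos (xi * x) + xi * sin (xi * x)) / (a ^+ 2 + xi ^+ 2).
pose F (x : R) := expR (- a * x) * u x.
pose du (x : R) := (- a * (- sin (xi * x) * xi) + xi * (cos (xi * x) * xi)) / (a ^+ 2 + xi ^+ 2).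
have dU (x : R) : is_derive x 1 u (du x).
  have := is_derD (is_derive_cst (- a^-1) x 1)
    (is_derM (is_derD (is_derZ (- a) (dcos x)) (is_derZ xi (dsin x)))
             (is_derive_cst ((a ^+ 2 + xi ^+ 2)^-1) x 1)).
  by move=> D; apply: (is_derive_eq D); rewrite mulr0 addr0 add0r.
have dF (x : R) : is_derive x 1 F (expR (- a * x) * (1 + cos (xi * x))).
  apply: (is_derive_eq (is_derM (dexp x) (dU x))).
  rewrite /u /du -mulrA -mulrDr; congr (_ * _).
  by field; rewrite !gt_eqF.
have f0 x : 0 <= f x.
  by rewrite mulr_ge0 ?expk_ge0// -lerBlDl sub0r; have := cos_geN1 (xi * x).
have cf : continuous f.
  move=> x; apply: cvgM; first exact: continuous_expk.
  by apply: cvgD; [exact: cvg_cst|exact: is_der_cvg (dcos x)].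
have F0 : F x @[x --> +oo] --> 0.
  pose C := a^-1 + (a + `|xi|) / (a ^+ 2 + xi ^+ 2).
  have FC x : `|F x| <= expR (- a * x) * C.
    rewrite normrM ger0_norm ?expR_ge0// ler_wpM2l ?expR_ge0//.
    apply: (le_trans (ler_normD _ _)); rewrite normrN gtr0_norm ?invr_gt0// lerD2l.
    rewrite normrM [`|_^-1|]gtr0_norm ?invr_gt0//.
    apply: ler_wpM2r; first by rewrite invr_ge0 ltW.
    apply: (le_trans (ler_normD _ _)); rewrite !normrM normrN (gtr0_norm a0) lerD//.
      by rewrite ler_piMr ?cos_max// ltW.
    by rewrite ler_piMr ?sin_max.
  have e0 : expR (- a * x) * C @[x --> +oo] --> 0.
    rewrite -[0](mul0r C); apply: cvgMl.
    have -> : (fun x => expR (- a * x)) = (fun x : R => expR (- x)) \o (fun x => a * x).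
      by apply/funext => x /=; rewrite mulNr.
    apply: cvg_comp (@cvgr_expR R).
    by apply: gt0_cvgMry.
  apply/cvgr0Pnorm_le => e e_0; move/cvgr0Pnorm_le : e0 => /(_ _ e_0).
  apply: filterS => x; apply: le_trans; apply: (le_trans (FC x)); exact: ler_norm.
rewrite /Rintegral.
have -> : (\int[mu]_x (f x)%:E = 2%:E * (0%:E - (F 0)%:E))%E.
  rewrite ge0_symfun_integralT//; last first.
    by move=> x; rewrite /f /expk/= normrN mulrN cosN.
  congr (_ * _)%E; rewrite (_ : [set x : R | 0 <= x] = `[0, +oo[%classic); last first.
    by apply/seteqP; split=> x /=; rewrite in_itv/= andbT.
  apply: ge0_continuous_FTC2y => //.
  - exact: continuous_subspaceT.
  - by apply: cvg_at_right_filter; exact: is_der_cvg (dF 0).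
  - move=> x; rewrite in_itv/= andbT => x0; rewrite derive1E; have [_ ->] := dF x.
    by rewrite /f /expk gtr0_norm// mulNr.
rewrite sub0e -EFinN -EFinM/= /F /u !mulr0 expR0 cos0 sin0 mul1r mulr1 mulr0 addr0.
by field; rewrite !gt_eqF.
Qed.

Lemma cosT_expk a (xi : R) : 0 < a -> cosT (expk a) xi = 2 * a / (a ^+ 2 + xi ^+ 2).
Proof.
move=> a0; have ei := integ_expk a0.
have e1 : 2 * \int[mu]_x expk a x = 4 / a.
  rewrite -RintegralZl//; transitivity (\int[mu]_x (expk a x * (1 + cos (0 * x)))).
    by apply: eq_Rint => x; rewrite mul0r cos0; ring.
  by rewrite expk_int1cos// expr0n/= addr0; field; rewrite gt_eqF.
have e2 := expk_int1cos xi a0.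
have : \int[mu]_x (expk a x * (1 + cos (xi * x))) = \int[mu]_x expk a x + cosT (expk a) xi.
  rewrite /cosT -RintegralD//; last exact: integ_cosM.
  by apply: eq_Rint => x; rewrite mulrDr mulr1.
rewrite e2; have -> : \int[mu]_x expk a x = 2 / a by lra.
by move=> /addrI.
Qed.

End ExponentialKernel.

(** * Spline profiles and the kernels that they define *)

Section SplineKernel.
Context {R : realType}.
Local Notation mu := (@lebesgue_measure R).

(** For [n > 0], the truncated power of spline theory; its derivative is again a truncated power. *)
Definition pp (n : nat) (t : R) : R := Num.max t 0 ^+ n.

Lemma continuous_pp n : continuous (pp n).
Proof.
move=> t; have H : {for t, continuous (fun s : R => Num.max s 0)}.
  by apply: (@continuous_max R R idfun (cst 0)); [exact: cvg_id|exact: cvg_cst].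
exact: (cvg_comp _ _ H (@exprn_continuous R n _)).
Qed.

Lemma is_der_exp n (t : R) : is_derive t 1 (fun z => z ^+ n.+1) (n.+1%:R * t ^+ n).
Proof.
elim: n => [|n ih]; first by rewrite expr0 mulr1; exact: is_derive_id.
have -> : (fun z : R => z ^+ n.+2) = (fun z => z ^+ n.+1 * z).
  by apply/funext => z; rewrite exprSr.
apply: (is_derive_eq (is_derM ih (is_derive_id t 1))).
by rewrite -mulrA -exprSr mulrC -mulrDr natr1 mulrC.
Qed.

Lemma is_der_pp n (t : R) : is_derive t 1 (pp n.+2) (n.+2%:R * pp n.+1 t).
Proof.
have [t0|t0|->] := ltgtP t 0.
- have E : pp n.+1 t = 0 by rewrite /pp max_r ?expr0n//= ltW.
  rewrite E mulr0; apply: near_eq_is_derive (is_derive_cst 0 t 1).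
  near=> z; rewrite /pp max_r ?expr0n//= ltW//.
  by near: z; exact: lt_nbhsl.
- have E : pp n.+1 t = t ^+ n.+1 by rewrite /pp max_l// ltW.
  have D : is_derive t 1 (fun z : R => z ^+ n.+2) (n.+2%:R * pp n.+1 t).
    by rewrite E; exact: is_der_exp.
  apply: near_eq_is_derive D.
  near=> z; rewrite /pp max_l// ltW//.
  by near: z; exact: lt_nbhsr.
(* At 0 the difference quotient is [pp n.+1] itself, which is continuous and vanishes there. *)
- rewrite {2}/pp maxxx expr0n mulr0; apply/is_derive1_caratheodory.
  exists (pp n.+1); split=> [z||]; last by rewrite /pp maxxx expr0n.
    rewrite subr0 {2}/pp maxxx expr0n subr0 /pp exprSr.
    by case: (leP z 0) => // _; rewrite expr0n !mul0r.
  exact: continuous_pp.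
Unshelve. all: by end_near. Qed.

(* The integral of the quadratic B-spline supported in [0, 3]: a C^2 step. *)
Definition spl (t : R) : R :=
  (pp 3 t - 3 * pp 3 (t - 1) + 3 * pp 3 (t - 2) - pp 3 (t - 3)) / 6.
Definition spl1 (t : R) : R :=
  (pp 2 t - 3 * pp 2 (t - 1) + 3 * pp 2 (t - 2) - pp 2 (t - 3)) / 2.
Definition spl2 (t : R) : R :=
  pp 1 t - 3 * pp 1 (t - 1) + 3 * pp 1 (t - 2) - pp 1 (t - 3).

Lemma is_der_comb n (t : R) :
  is_derive t 1
   (fun t => pp n.+2 t - 3 * pp n.+2 (t - 1) + 3 * pp n.+2 (t - 2) - pp n.+2 (t - 3))
   (n.+2%:R * (pp n.+1 t - 3 * pp n.+1 (t - 1) + 3 * pp n.+1 (t - 2) - pp n.+1 (t - 3))).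
Proof.
have sh (k : R) : is_derive t 1 (fun t => pp n.+2 (t - k)) (n.+2%:R * pp n.+1 (t - k)).
  have D : is_derive t 1 (fun t => t - k) 1.
    by apply: (is_derive_eq (is_derB (is_derive_id t 1) (is_derive_cst k t 1))); rewrite subr0.
  have := @is_derive1_comp _ (pp n.+2) (fun t => t - k) t _ _ (is_der_pp n (t - k)) D.
  by rewrite mulr1.
apply: (is_derive_eq (is_derB (is_derD (is_derB (is_der_pp n t) (is_derZ 3 (sh 1)))
  (is_derZ 3 (sh 2))) (sh 3))).
ring.
Qed.

Lemma is_der_spl (t : R) : is_derive t 1 spl (spl1 t).
Proof.
have := is_derM (is_der_comb 1 t) (is_derive_cst (6^-1 : R) t 1).
by move=> D; apply: (is_derive_eq D); rewrite mulr0 addr0 /spl1/=; field.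
Qed.

Lemma is_der_spl1 (t : R) : is_derive t 1 spl1 (spl2 t).
Proof.
have := is_derM (is_der_comb 0 t) (is_derive_cst (2^-1 : R) t 1).
by move=> D; apply: (is_derive_eq D); rewrite mulr0 addr0 /spl2/=; field.
Qed.

Lemma continuous_spl2 : continuous spl2.
Proof.
move=> t; have sh (k : R) : {for t, continuous (fun t => pp 1 (t - k))}.
  apply: (@continuous_comp _ _ _ (fun t => t - k) (pp 1)); last exact: continuous_pp.
  by apply: cvgB; [exact: cvg_id|exact: cvg_cst].
exact: (cvgB (cvgD (cvgB (@continuous_pp 1 t) (cvgM (cvg_cst _) (sh 1)))
  (cvgM (cvg_cst _) (sh 2))) (sh 3)).
Qed.

Lemma pp_le0 n (t : R) : t <= 0 -> pp n.+1 t = 0.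
Proof. by move=> t0; rewrite /pp max_r// expr0n. Qed.

Lemma pp_ge0 n (t : R) : 0 <= t -> pp n t = t ^+ n.
Proof. by move=> t0; rewrite /pp max_l. Qed.

Lemma spl_le0 t : t <= 0 -> spl t = 0.
Proof. by move=> t0; rewrite /spl !pp_le0; [ring|lra..]. Qed.

Lemma spl1_le0 t : t <= 0 -> spl1 t = 0.
Proof. by move=> t0; rewrite /spl1 !pp_le0; [ring|lra..]. Qed.

Lemma spl_ge3 t : 3 <= t -> spl t = 1.
Proof. by move=> t0; rewrite /spl !pp_ge0; [field|lra..]. Qed.

Lemma spl1_ge3 t : 3 <= t -> spl1 t = 0.
Proof. by move=> t0; rewrite /spl1 !pp_ge0; [field|lra..]. Qed.

Lemma spl_ge0 t : 0 <= spl t.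
Proof.
rewrite /spl divr_ge0//.
have [t0|t0] := leP t 0; first by rewrite !pp_le0; [lra..].
have [t1|t1] := leP t 1.
  rewrite (@pp_ge0 _ t) ?(ltW t0)// !pp_le0; [|lra..].
  have := exprn_ge0 3 (ltW t0); lra.
have [t2|t2] := leP t 2.
  rewrite (@pp_ge0 _ t) ?(ltW t0)// (@pp_ge0 _ (t - 1)); last lra.
  rewrite !pp_le0; [|lra..].
  (* This says [(t - 1) ^+ 3 <= (t - 1) ^+ 2], the hint that settles the cubic inequality. *)
  have : 0 <= (2 - t) * (t - 1) ^+ 2 by rewrite mulr_ge0 ?sqr_ge0// subr_ge0.
  nra.
have [t3|t3] := leP t 3; last by rewrite !pp_ge0; [nra|lra..].
rewrite (@pp_ge0 _ t) ?(ltW t0)// (@pp_ge0 _ (t - 1)); last lra.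
rewrite (@pp_ge0 _ (t - 2)); last lra.
rewrite !pp_le0; last lra.
(* On the last piece the symmetry [spl t = 1 - spl (3 - t)] leaves a single cube. *)
have -> : t ^+ 3 - 3 * (t - 1) ^+ 3 + 3 * (t - 2) ^+ 3 - 0 = 6 - (3 - t) ^+ 3 by ring.
have h : (3 - t) ^+ 3 <= 1 by rewrite exprn_ile1//; lra.
lra.
Qed.

Section Dilation.
Variables (l : R) (l0 : 0 < l).

(** The step is run backwards: the profile is 1 up to [l] and falls to 0 between [l] and [4 * l]. It
    is constant near 0, so its even extension is still C^2. *)
Definition prof (y : R) : R := spl (4 - y / l).
Definition prof1 (y : R) : R := - l^-1 * spl1 (4 - y / l).
Definition prof2 (y : R) : R := l ^- 2 * spl2 (4 - y / l).

Let aff (y : R) : is_derive y 1 (fun y => 4 - y / l) (- l^-1).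
Proof.
have := is_derB (is_derive_cst (4 : R) y 1)
  (is_derM (is_derive_id y 1) (is_derive_cst (l^-1) y 1)).
by move=> D; apply: (is_derive_eq D); rewrite mulr0 addr0 mul1r sub0r.
Qed.

Lemma is_der_prof (y : R) : is_derive y 1 prof (prof1 y).
Proof.
have := @is_derive1_comp _ spl (fun y => 4 - y / l) y _ _ (is_der_spl _) (aff y).
by move=> D; apply: (is_derive_eq D); rewrite mulrC.
Qed.

Lemma is_der_prof1 (y : R) : is_derive y 1 prof1 (prof2 y).
Proof.
have := is_derZ (- l^-1)
  (@is_derive1_comp _ spl1 (fun y => 4 - y / l) y _ _ (is_der_spl1 _) (aff y)).
move=> D; apply: (is_derive_eq D); rewrite /prof2 -exprVn expr2; ring.
Qed.

Lemma continuous_prof2 : continuous prof2.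
Proof.
move=> y; apply: cvgM; first exact: cvg_cst.
exact: (cvg_comp _ _ (is_der_cvg (aff y)) (@continuous_spl2 _)).
Qed.

Lemma prof_eq1 y : y <= l -> prof y = 1 /\ prof1 y = 0.
Proof.
move=> yl; have h : 3 <= 4 - y / l.
  by rewrite lerBrDl -lerBrDr ler_pdivrMr//; lra.
by rewrite /prof /prof1 spl_ge3// spl1_ge3// mulr0.
Qed.

Lemma prof_eq0 y : 4 * l <= y -> prof y = 0 /\ prof1 y = 0.
Proof.
move=> yl; have h : 4 - y / l <= 0 by rewrite subr_le0 ler_pdivlMr.
by rewrite /prof /prof1 spl_le0// spl1_le0// mulr0.
Qed.

Lemma prof_ge0 y : 0 <= prof y. Proof. exact: spl_ge0. Qed.

(** The kernel [V_l] of the overview, of de la Vallee Poussin type but with a C^2 profile. *)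
Definition splk : R -> R := cosT (prof \_ `[0, 4 * l]).

Lemma C2_bound (a b : R) (A A1 A2 : R -> R) : a <= b ->
  (forall x, x \in `[a, b] -> [/\ is_derive x 1 A (A1 x), is_derive x 1 A1 (A2 x)
     & {for x, continuous A2}]) ->
  exists B L, 1 <= L /\ C2 a b L B A A1 A2.
Proof.
move=> ab dA.
have [B B0 AB] : exists2 K, 0 < K & forall x, x \in `[a, b] -> `|A x| <= K.
  by apply: itv_bounded => //; apply: within_continuous_at => x /dA[/is_der_cvg].
have [L L1 CL] := C2_of_continuous ab B0 dA AB.
by exists B, L; split=> //; exact: CL.
Qed.

Lemma integ_splk : integ splk.
Proof.
have l4 : 0 < 4 * l by rewrite mulr_gt0.
have [B [L [L1 CL]]] := C2_bound (ltW l4)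
  (fun x _ => And3 (is_der_prof x) (is_der_prof1 x) (@continuous_prof2 x)).
have [h1 h2] := prof_eq0 (lexx _); have [_ h3] := prof_eq1 (ltW l0).
have [] // := cosT_C2_L1 (lexx 0) l4 (le_trans ler01 L1) CL h1 h2 h3 (or_intror erefl).
Qed.

Lemma integ_prof_patch : integ (prof \_ `[0, 4 * l]).
Proof.
apply: within_itv_integ; apply: within_continuous_at => x _.
exact: is_der_cvg (is_der_prof x).
Qed.

End Dilation.

Lemma splk_scale l x : 0 < l -> splk l x = l * splk 1 (l * x).
Proof.
move=> l0; have ln0 : l != 0 by rewrite gt_eqF.
rewrite /splk /cosT.
have := Rint_affine 0 ln0 (integ_cosM x (integ_prof_patch l)).
rewrite gtr0_norm// => /(congr1 (fun z => l * z)); rewrite mulrA divff// mul1r => <-.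
congr (l * _); apply: eq_Rint => y; rewrite addr0; congr (_ * cos _); last by ring.
rewrite !patchE; congr (if _ then _ else _).
  apply/idP/idP; rewrite !inE/= !in_itv/= mulr1 pmulr_rge0// mulrC ler_pM2r//.
by rewrite /prof divr1 mulrC mulKf.
Qed.

(** Both profiles are 1 up to [m], so their difference is carried by [[m, 4 * l]], where the
    transform of [f] has no zero. *)
Lemma splkB_local (p f : R -> R) (M l m : R) : bm p M -> integ f ->
  cv p f x @[x --> +oo] --> 0 -> 0 < m -> m < l ->
  (forall x, 0 < x -> 0 < power f x) ->
  lsup (cv p (fun x => splk l x - splk m x)) 0.
Proof.
move=> bp fi pf0 m0 ml fpos; have l0 := lt_trans m0 ml.
have ml4 : m < 4 * l by lra.
pose D x := prof l x - prof m x; pose D1 x := prof1 l x - prof1 m x.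
pose D2 x := prof2 l x - prof2 m x.
have [B [L [L1 CL]]] : exists B L, 1 <= L /\ C2 m (4 * l) L B D D1 D2.
  apply: C2_bound; first exact: ltW.
  move=> x _; split.
  - by apply: is_derB; exact: is_der_prof.
  - by apply: is_derB; exact: is_der_prof1.
  - by apply: cvgB; exact: continuous_prof2.
(* [wiener_local] chooses a scale of its own and expects bounds at scale 1; [L ^+ 2 * B] dominates
   all three. *)
have CD : C2 m (4 * l) 1 (L ^+ 2 * B) D D1 D2.
  move=> x xab; have [? ? ? [b0 b1 b2]] := CL x xab.
  have B0 := le_trans (normr_ge0 _) b0.
  have L2 : L <= L ^+ 2 by rewrite expr2 ler_peMl// (le_trans _ L1).
  split=> //; rewrite expr1n !mul1r; split=> //.
  - by apply: (le_trans b0); rewrite ler_peMl// (le_trans L1).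
  - by apply: (le_trans b1); rewrite ler_wpM2r.
have [e1 e2] := prof_eq1 l0 (ltW ml); have [e3 e4] := prof_eq1 m0 (lexx m).
have [e5 e6] := prof_eq0 l0 (lexx _).
have [e7 e8] : prof m (4 * l) = 0 /\ prof1 m (4 * l) = 0 by apply: prof_eq0 => //; lra.
have E : (fun x => splk l x - splk m x) = cosT (D \_ `[m, 4 * l]).
  apply/funext => x; rewrite /splk /cosT -RintegralB//; last 2 first.
  - exact: integ_cosM (integ_prof_patch l).
  - exact: integ_cosM (integ_prof_patch m).
  apply: eq_Rint => y; rewrite -mulrBl; congr (_ * _).
  rewrite !patchE !mem_setE !in_itv/=.
  have [y0|y0] := ltP y 0.
    by rewrite /= (lt_geF (lt_trans y0 m0))/= subrr.
  have [ym|my] := ltP y m.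
    rewrite /= (_ : y <= 4 * l); last by lra.
    rewrite (_ : y <= 4 * m); last by lra.
    have [-> _] := prof_eq1 l0 (ltW (lt_trans ym ml)).
    by have [-> _] := prof_eq1 m0 (ltW ym); rewrite subrr.
  rewrite /=; have [yl|yl] := leP y (4 * l); last first.
    by rewrite leNgt (lt_trans _ yl) ?ltr_pM2l//= subrr.
  have [//|ym4] := leP y (4 * m).
  by rewrite /D; have [-> _] := prof_eq0 m0 (ltW ym4).
rewrite E; apply: (wiener_local bp fi pf0 (ltW m0) ml4 _ CD).
- by move=> x; rewrite in_itv/= => /andP[mx _]; apply: fpos; exact: lt_le_trans mx.
- by rewrite /D e1 e3 subrr.
- by rewrite /D e5 e7 subrr.
- by rewrite /D1 e2 e4 subrr.
- by rewrite /D1 e6 e8 subrr.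
Qed.

End SplineKernel.

(** * Density of compactly supported continuous functions and continuity of translation in L1 *)

Section TranslationContinuity.
Context {R : realType}.
Local Notation mu := (@lebesgue_measure R).

Definition cutoff (n : R) (t : R) : R := Num.max 0 (Num.min 1 (n + 1 - `|t|)).

Lemma continuous_cutoff n : continuous (cutoff n).
Proof.
move=> t; have H : {for t, continuous (fun t : R => n + 1 - `|t|)}.
  by apply: cvgB; [exact: cvg_cst|exact: cvg_norm].
have H1 : {for t, continuous (fun t : R => Num.min 1 (n + 1 - `|t|))}.
  by apply: (@continuous_min R R (cst 1) _ t) => //; exact: cvg_cst.
by apply: (@continuous_max R R (cst 0) _ t) => //; exact: cvg_cst.
Qed.

Lemma cutoff_itv n t : 0 <= cutoff n t <= 1.
Proof. by rewrite /cutoff le_max lexx/= ge_max ler01 ge_min lexx. Qed.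

Lemma cutoff1 n t : `|t| <= n -> cutoff n t = 1.
Proof.
move=> tn; rewrite /cutoff min_l ?max_r//; lra.
Qed.

Lemma cutoff0 n t : n + 1 <= `|t| -> cutoff n t = 0.
Proof.
move=> tn; rewrite /cutoff max_l// ge_min; apply/orP; right; lra.
Qed.

Lemma continuous_compact_bounded (k : R -> R) (N : R) : 0 <= N -> continuous k ->
  (forall t, N <= `|t| -> k t = 0) -> exists2 K, 0 < K & forall t, `|k t| <= K.
Proof.
move=> N0 ck k0.
have [K K0 kK] : exists2 K, 0 < K & forall x, x \in `[- N, N] -> `|k x| <= K.
  apply: itv_bounded; first lra.
  by apply: within_continuous_at => x _; exact: ck.
exists K => // t; have [tN|Nt] := leP (`|t|) N.
  by apply: kK; rewrite in_itv/= -ler_norml.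
by rewrite k0 ?normr0 ?ltW.
Qed.

Lemma compact_integ (k : R -> R) (N : R) : 0 <= N -> continuous k ->
  (forall t, N <= `|t| -> k t = 0) -> integ k.
Proof.
move=> N0 ck k0.
have := @within_itv_integ _ k (- N) N (within_continuous_at (fun x _ => @ck x)).
congr (mu.-integrable _ _); apply/funext => t /=; rewrite patchE.
case: ifPn => //; rewrite notin_setE/= in_itv/= -ler_norml => /negP.
by rewrite -ltNge => /ltW/k0 ->.
Qed.

(** Continuous approximants are close to [h] only on a set of finite measure and may be large
    outside, so one is multiplied by a continuous cutoff supported in that set. *)
Lemma L1_dense_compact (h : R -> R) (e : R) : integ h -> 0 < e ->
  exists (k : R -> R) (N : R), [/\ 0 <= N, continuous k,
    forall t, N <= `|t| -> k t = 0 & \int[mu]_t `|h t - k t| <= e].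
Proof.
move=> hi e0; have e2 : 0 < e / 2 by rewrite divr_gt0.
have [n hn] := trunc_L1_cvg hi e2.
pose E : set R := `[- (n%:R + 1), n%:R + 1]%classic.
have mE : measurable E by exact: measurable_itv.
have Efin : (mu E < +oo)%E.
  by rewrite lebesgue_measure_itv/=; case: ifPn => // _; rewrite -EFinD ltry.
have hE : mu.-integrable E (EFin \o h) by exact: (integrableS measurableT _ _ hi).
have [g_ [cg ig /fine_cvgP[_ ]]] := approximation_continuous_integrable mE Efin hE.
move=> /cvgr0Pnorm_le/(_ _ e2)[m _ /(_ m (leqnn m)) hg].
pose k t := cutoff n%:R t * g_ m t.
have ck : continuous k by move=> t; apply: cvgM; [exact: continuous_cutoff|exact: cg].
have k0 t : n%:R + 1 <= `|t| -> k t = 0 by move=> nt; rewrite /k cutoff0// mul0r.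
have N0 : 0 <= n%:R + 1 :> R by rewrite addr_ge0.
exists k, (n%:R + 1); split=> //.
have ki := compact_integ N0 ck k0.
pose d := (fun t => h t - g_ m t) \_ E.
have di : integ d.
  rewrite /integ -restrict_EFin; apply/integrable_restrict => //; rewrite setTI.
  exact: (integrableB _ hE (ig m)).
have dle : \int[mu]_t `|d t| <= e / 2.
  apply: le_trans hg; rewrite /=; apply: le_trans (ler_norm _).
  rewrite -[leRHS]/(\int[mu]_(t in E) `|h t - g_ m t|) Rintegral_mkcond.
  apply: Rint_le; first exact: integ_norm.
    have := integ_norm di; congr (mu.-integrable _ _); apply/funext => t /=.
    by rewrite /d !patchE; case: ifPn; rewrite ?normr0.
  by move=> t; rewrite /d !patchE; case: ifPn; rewrite ?normr0.
apply: (@le_trans _ _ (\int[mu]_t (`|h t - trunc h n t| + `|d t|))).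
  apply: Rint_le; first by apply: integ_norm; exact: integB.
    apply: integD; last exact: integ_norm.
    by apply: integ_norm; apply: integB => //; exact: integ_trunc.
  move=> t; have /andP[c0 c1] := cutoff_itv n%:R t.
  rewrite /d /trunc !patchE !mem_setE !in_itv/= -!ler_norml.
  have [tn|tn] := leP (`|t|) n%:R.
    rewrite (le_trans tn) ?lerDl// /k cutoff1// mul1r subrr normr0 add0r//.
  rewrite subr0; have [tn1|tn1] := leP (`|t|) (n%:R + 1); last first.
    by rewrite (k0 _ (ltW tn1)) subr0 -[point]/(0 : R) normr0 addr0.
  (* In the transition zone the truncation of [h] is 0, so [|h t|] itself is available from the
     truncation error and pays for the first summand. *)
  rewrite (_ : h t - k t = (1 - cutoff n%:R t) * h t + cutoff n%:R t * (h t - g_ m t)); last first.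
    by rewrite /k; ring.
  apply: (le_trans (ler_normD _ _)); rewrite !normrM.
  have -> : `|1 - cutoff n%:R t| = 1 - cutoff n%:R t by rewrite ger0_norm// subr_ge0.
  rewrite (ger0_norm c0); apply: lerD; rewrite ler_piMl//; lra.
rewrite RintegralD//; last 2 first.
- by apply: integ_norm; apply: integB => //; exact: integ_trunc.
- exact: integ_norm.
lra.
Qed.

Lemma L1_shift_cvg (h : R -> R) (e : R) : integ h -> 0 < e ->
  exists2 d, 0 < d & forall s, `|s| <= d -> \int[mu]_t `|h (t + s) - h t| <= e.
Proof.
move=> hi e0; have e3 : 0 < e / 3 by rewrite divr_gt0.
have [k [N [N0 ck k0 hk]]] := L1_dense_compact hi e3.
have ki := compact_integ N0 ck k0.
have [K K0 kK] := continuous_compact_bounded N0 ck k0.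
have Kd : exists2 d, 0 < d & forall s, `|s| <= d -> \int[mu]_t `|k (t + s) - k t| <= e / 3.
  (* A counterexample for each [n.+1%:R^-1] gives a sequence of shifts, to which dominated
     convergence applies. *)
  apply: contrapT => H.
  have /choice[s sP] : forall n : nat, exists s : R,
      `|s| <= n.+1%:R^-1 /\ e / 3 < \int[mu]_t `|k (t + s) - k t|.
    move=> n; apply: contrapT => H1; apply: H; exists n.+1%:R^-1 => // s sn.
    by rewrite leNgt; apply/negP => es; apply: H1; exists s.
  have s0 : s n @[n --> \oo] --> 0.
    apply/cvgr0Pnorm_le => e' e'0.
    have := near_infty_natSinv_lt (PosNum e'0); apply: filterS => n /ltW.
    exact: le_trans (sP n).1.
  have : \int[mu]_t `|k (t + s n) - k t| @[n --> \oo] --> \int[mu]_t (0 : R).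
    (* The shifts are at most 1, so [k] and its translates all vanish beyond [N + 1]. *)
    apply: (@dct _ _ _ ((fun=> 2 * K) \_ `[- (N + 1), N + 1])).
    - move=> n; apply: (measurableT_comp (@normr_measurable R setT)).
      by apply: measurable_funB; [exact: integ_meas (integ_shift _ ki)|exact: integ_meas ki].
    - by apply: within_itv_integ => t; exact: cvg_cst.
    - move=> n t; rewrite normr_id patchE mem_setE in_itv/= -ler_norml.
      have [tN|tN] := leP (`|t|) (N + 1).
        apply: (le_trans (ler_normB _ _)).
        by have := kK t; have := kK (t + s n); lra.
      have sn1 : `|s n| <= 1 by rewrite (le_trans (sP n).1)// invf_le1// ler1n.
      rewrite !k0 ?subrr ?normr0//; first by rewrite ltW// (lt_trans _ tN)// ltrDl.
      have := ler_normB (t + s n) (s n); rewrite addrK; lra.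
    - move=> t; rewrite -[0](normr0 R) -(subrr (k t)).
      apply: cvg_norm; apply: cvgB; last exact: cvg_cst.
      have ts : t + s n @[n --> \oo] --> t.
        by rewrite -[X in _ --> X]addr0; apply: cvgD => //; exact: cvg_cst.
      exact: (cvg_comp _ _ ts (@ck t)).
  rewrite Rintegral_cst// mul0r => /cvgr0Pnorm_le/(_ _ e3)[n _ /(_ n (leqnn n))].
  rewrite ger0_norm ?integ_L1_ge0// leNgt.
  by have [_ ->] := sP n.
have [d d0 kd] := Kd; exists d => // s /kd ks.
have i1 := integB hi ki; have i2 := integ_shift s i1.
have i3 := integB (integ_shift s ki) ki.
apply: (@le_trans _ _ (\int[mu]_t (`|h (t + s) - k (t + s)| + `|k (t + s) - k t| + `|h t - k t|))).
  apply: Rint_le.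
  - by apply: integ_norm; apply: integB => //; exact: integ_shift.
  - by apply: integD; [apply: integD|]; exact: integ_norm.
  - move=> t; rewrite [`|h t - k t|]distrC.
    rewrite (_ : h (t + s) - h t = 
      (h (t + s) - k (t + s)) + (k (t + s) - k t) + (k t - h t)); last by ring.
    by apply: (le_trans (ler_normD _ _)); rewrite lerD2r ler_normD.
rewrite RintegralD//; [|by apply: integD; exact: integ_norm|exact: integ_norm].
rewrite RintegralD//; [|exact: integ_norm..].
rewrite (@Rint_shift _ s (fun t => `|h t - k t|) (integ_norm i1)).
lra.
Qed.

End TranslationContinuity.

(** * Dilated kernels at high and low frequency, and the Tauberian theorem with a zero at the
    origin *)

Section Wiener.
Context {R : realType}.
Local Notation mu := (@lebesgue_measure R).

(* Abel summation of the cosine transform of [prof 1]. *)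
Lemma splk_int_gt0 : 0 < \int[mu]_x splk 1 x.
Proof.
have iV : integ (splk 1 : R -> R) := integ_splk (@ltr01 R).
pose G := (prof 1 : R -> R) \_ `[0, 4 * 1].
have iG : integ G by exact: integ_prof_patch.
have G0 y : 0 <= G y by rewrite /G patchE; case: ifPn => // _; exact: prof_ge0.
have Abel e : 0 < e -> e <= 1 -> 1 <= \int[mu]_x (splk 1 x * expk e x).
  move=> e0 e1; have ei := integ_expk e0.
  have -> : \int[mu]_x (splk 1 x * expk e x) =
      \int[mu]_t (\int[mu]_y (G y * cos ((0 - t) * y)) * expk e t).
    apply: eq_Rint => t; congr (_ * _); apply: eq_Rint => y; congr (_ * _).
    by rewrite sub0r mulNr cosN.
  rewrite (@cv_trig_fubini _ G (expk e) cos 0 (@cos_max R) measurable_cos iG ei).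
  have -> : \int[mu]_y (G y * \int[mu]_t (expk e t * cos ((0 - t) * y))) =
      \int[mu]_y (G y * (2 * e / (e ^+ 2 + y ^+ 2))).
    apply: eq_Rint => y; rewrite -(cosT_expk y e0); congr (_ * _).
    by apply: eq_Rint => t; rewrite sub0r mulNr cosN mulrC mulrC [t * y]mulrC.
  (* On [[0, e]] the profile is 1, as [e <= 1], and [2 * e / (e ^+ 2 + y ^+ 2)] is at least [e^-1];
     elsewhere the integrand is nonnegative. *)
  rewrite [leLHS](_ : 1 = \int[mu]_y ((fun=> e^-1) \_ `[0, e]) y); last first.
    rewrite -Rintegral_mkcond Rintegral_cst//= lebesgue_measure_itv/= lte_fin e0.
    by rewrite -EFinD/= subr0 mulVf// gt_eqF.
  apply: Rint_le.
  - by apply: within_itv_integ => t; exact: cvg_cst.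
  - have := integ_Mbm iG (bm_cosT ei); congr (mu.-integrable _ _).
    by apply/funext => y /=; rewrite cosT_expk.
  - move=> y; have d0 : 0 < e ^+ 2 + y ^+ 2 by rewrite ltr_pwDl ?sqr_ge0// exprn_gt0.
    rewrite patchE mem_setE in_itv/=; case: ifPn => [/andP[y0 ye]|_]; last first.
      by rewrite mulr_ge0// divr_ge0// ?mulr_ge0// ltW.
    have -> : G y = 1.
      rewrite /G patchE mem_setE in_itv/= y0/= ifT; last by lra.
      by have [-> _] := prof_eq1 ltr01 (le_trans ye e1).
    rewrite mul1r ler_pdivlMr// mulrDr.
    have -> : e^-1 * e ^+ 2 = e by rewrite expr2 mulKf// gt_eqF.
    have : e^-1 * y ^+ 2 <= e.
      by rewrite ler_pdivrMl// -expr2 ler_sqr ?nnegrE// ltW.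
    lra.
have cv1 : \int[mu]_x (splk 1 x * expk n.+1%:R^-1 x) @[n --> \oo] --> \int[mu]_x splk 1 x.
  apply: (@dct _ (fun n x => splk 1 x * expk n.+1%:R^-1 x) (splk 1) (fun x => `|splk 1 x|)).
  - move=> n; apply: measurable_funM; first exact: integ_meas iV.
    by apply: continuous_measurable_fun; exact: continuous_expk.
  - exact: integ_norm.
  - move=> n x; rewrite normrM ler_piMr// ger0_norm ?expk_ge0//.
    by rewrite /expk expR_le1 oppr_le0 mulr_ge0.
  - move=> x; rewrite -[X in _ --> X]mulr1; apply: cvgMr.
    have h0 : - (n.+1%:R^-1 * `|x|) @[n --> \oo] --> (0 : R).
      by rewrite -oppr0 -(mul0r `|x|); apply: cvgN; apply: cvgMl; exact: cvg_harmonic.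
    by have := cvg_comp _ _ h0 (@continuous_expR R 0); rewrite expR0.
have cst1 : (1 : R) @[_ --> \oo] --> (1 : R) by exact: cvg_cst.
apply: (lt_le_trans ltr01); apply: (ler_cvg_to cst1 cv1).
by apply: nearW => n; apply: Abel; rewrite ?invr_gt0 ?invf_le1// ler1n.
Qed.

Lemma div_succ_le (a n : R) : 0 <= a -> 0 <= n -> a / (n + 1) * n <= a.
Proof.
move=> a0 n0; have n1 : 0 < n + 1 by rewrite ltr_wpDl.
by rewrite mulrAC ler_pdivrMr// ler_wpM2l// lerDl.
Qed.

Definition dil (V : R -> R) (l t : R) : R := l * V (l * t).

Lemma integ_dil V (l : R) : 0 < l -> integ V -> integ (dil V l).
Proof.
move=> l0 iV; have ln0 : l != 0 by rewrite gt_eqF.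
have := integZ l (integ_affine 0 ln0 iV).
by congr (mu.-integrable _ _); apply/funext => t /=; rewrite addr0.
Qed.

(** Approximate identity. Substitution turns the kernel into [V t] against [u (x - l^-1 * t)]: for
    [|t| <= n] the shift is at most [d] and uniform continuity applies; the rest costs [2 * C] times
    the tail of [V]. *)
Lemma cv_dil_high (u V : R -> R) C e : bm u C -> integ V -> 0 < e ->
  (forall e, 0 < e -> exists2 d, 0 < d & forall s x, `|s| <= d -> `|u (x + s) - u x| <= e) ->
  exists2 l0, 0 < l0 & forall l, l0 <= l -> forall x,
    `|cv u (dil V l) x - (\int[mu]_t V t) * u x| <= e.
Proof.
move=> bu iV e0 uc; have C0 := bm_ge0 bu; have [mu_ uC] := bu.
pose N := \int[mu]_t `|V t|.
have N0 : 0 <= N by exact: integ_L1_ge0.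
have e1 : 0 < e / 2 / (N + 1) by rewrite !divr_gt0// ltr_wpDl.
have e2 : 0 < e / 2 / (2 * C + 1) by rewrite !divr_gt0// ltr_wpDl// mulr_ge0.
have [d d0 ud] := uc _ e1.
have [n hn] := trunc_L1_cvg iV e2.
exists ((n%:R + 1) / d); first by rewrite divr_gt0// ltr_wpDl.
move=> l ll x; have l0 : 0 < l by apply: lt_le_trans ll; rewrite divr_gt0// ltr_wpDl.
have ln0 : l != 0 by rewrite gt_eqF.
have bux : bm (fun y => u (x - l^-1 * y)) C.
  split=> //; apply: (measurableT_comp mu_); apply: measurable_funB => //.
have iux : integ (fun y => u (x - l^-1 * y) * V y) by exact: integ_bM bux.1 bux.2 iV.
have E1 : cv u (dil V l) x = \int[mu]_y (u (x - l^-1 * y) * V y).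
  have E0 := Rint_affine 0 ln0 iux; rewrite (gtr0_norm l0) in E0.
  transitivity (l * (l^-1 * \int[mu]_y (u (x - l^-1 * y) * V y))); last first.
    by rewrite mulVKf.
  rewrite -E0.
  rewrite -RintegralZl//; last exact: (integ_affine 0 ln0 iux).
  apply: eq_Rint => t; by rewrite /dil addr0 mulKf// mulrCA.
have iVu : integ (fun t => V t * u x).
  by apply: (integ_Mbm (u := fun=> u x) (M := C) iV); split.
have -> : (\int[mu]_t V t) * u x = \int[mu]_t (V t * u x).
  by rewrite (RintegralZr _ measurableT iV).
rewrite E1 -(RintegralB measurableT iux iVu).
pose q := trunc V n.
have qi : integ q by exact: integ_trunc.
have di := integB iV qi.
apply: (@le_trans _ _ (\int[mu]_t (e / 2 / (N + 1) * `|V t| + 2 * C * `|V t - q t|))).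
  apply: Rint_norm_le.
  - exact: integ_meas (integB iux iVu).
  - by apply: integD; apply: integZ; exact: integ_norm.
  - move=> t; rewrite [V t * u x]mulrC -mulrBl normrM.
    have [tn|tn] := leP (`|t|) n%:R.
      apply: (@le_trans _ _ (e / 2 / (N + 1) * `|V t|)).
        rewrite ler_wpM2r//; apply: ud; rewrite normrN normrM gtr0_norm ?invr_gt0//.
        rewrite ler_pdivrMl//; apply: (le_trans tn).
        rewrite ler_pdivrMr// in ll; apply: le_trans ll; rewrite lerDl//.
      by rewrite lerDl mulr_ge0// mulr_ge0.
    have -> : q t = 0.
      by rewrite /q /trunc patchE mem_setE in_itv/= -ler_norml leNgt tn.
    rewrite subr0; apply: (@le_trans _ _ (2 * C * `|V t|)).
      rewrite ler_wpM2r//; apply: (le_trans (ler_normB _ _)).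
      by have := uC (x - l^-1 * t); have := uC x; lra.
    by rewrite lerDr mulr_ge0// ltW.
have iVn := integ_norm iV; have idn := integ_norm di.
rewrite (RintegralD measurableT (integZ _ iVn) (integZ _ idn)).
rewrite (RintegralZl _ measurableT iVn) (RintegralZl _ measurableT idn).
rewrite -/N [leRHS](splitr e); apply: lerD.
  by apply: div_succ_le => //; rewrite divr_ge0// ltW.
apply: (@le_trans _ _ (2 * C * (e / 2 / (2 * C + 1)))); first by rewrite ler_wpM2l// mulr_ge0.
by rewrite mulrC; apply: div_succ_le; [rewrite divr_ge0// ltW|exact: mulr_ge0].
Qed.

(** Translating the dilated kernel by [s] amounts to translating [V] by [m * s], a small change in
    L1 when [m] is small. *)
Lemma cv_dil_low (u V : R -> R) C e s : bm u C -> integ V -> 0 < e ->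
  exists2 m0, 0 < m0 & forall m, 0 < m -> m <= m0 -> forall x,
    `|cv u (dil V m) (x + s) - cv u (dil V m) x| <= e.
Proof.
move=> bu iV e0; have C0 := bm_ge0 bu.
have e1 : 0 < e / (C + 1) by rewrite divr_gt0// ltr_wpDl.
have [d d0 hd] := L1_shift_cvg iV e1.
exists (d / (`|s| + 1)); first by rewrite divr_gt0// ltr_wpDl.
move=> m m_0 md x; have mn0 : m != 0 by rewrite gt_eqF.
have iVm := integ_dil m_0 iV; have iVms := integ_shift s iVm.
have -> : cv u (dil V m) (x + s) = cv u (fun t => dil V m (t + s)) x.
  have := Rint_shift s (integ_cv (x + s) bu iVm); rewrite /cv => <-.
  by apply: eq_Rint => t; congr (u _ * _); ring.
rewrite -(cvBr x bu iVms iVm).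
apply: (le_trans (norm_cv_le x bu (integB iVms iVm))).
have i1 := integ_norm (integB (integ_shift (m * s) iV) iV).
have -> : \int[mu]_t `|dil V m (t + s) - dil V m t| = \int[mu]_t `|V (t + m * s) - V t|.
  have E0 := Rint_affine 0 mn0 i1; rewrite (gtr0_norm m_0) in E0.
  transitivity (m * (m^-1 * \int[mu]_t `|V (t + m * s) - V t|)); last first.
    by rewrite mulVKf.
  rewrite -E0.
  rewrite -RintegralZl//; last exact: (integ_affine 0 mn0 i1).
  apply: eq_Rint => t; rewrite /dil addr0 -mulrBr normrM gtr0_norm//.
  by rewrite mulrDr.
have h : `|m * s| <= d.
  rewrite normrM gtr0_norm//; apply: (@le_trans _ _ (m * (`|s| + 1))).
    by rewrite ler_wpM2l ?lerDl// ltW.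
  by rewrite -ler_pdivlMr// ltr_wpDl.
apply: (@le_trans _ _ (C * (e / (C + 1)))); first by rewrite ler_wpM2l// hd.
by rewrite mulrC; apply: div_succ_le => //; exact: ltW.
Qed.

(** This is what averaging by [h] is for: [p] may be discontinuous, whereas [cv_dil_high] asks for a
    uniform modulus of continuity. *)
Lemma cv_unif_continuous (p h : R -> R) M e : bm p M -> integ h -> 0 < e ->
  exists2 d, 0 < d & forall s x, `|s| <= d -> `|cv p h (x + s) - cv p h x| <= e.
Proof.
move=> bp hi e0; have M0 := bm_ge0 bp.
have e1 : 0 < e / (M + 1) by rewrite divr_gt0// ltr_wpDl.
have [d d0 hd] := L1_shift_cvg hi e1; exists d => // s x sd.
have his := integ_shift s hi.
have -> : cv p h (x + s) = cv p (fun t => h (t + s)) x.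
  have := Rint_shift s (integ_cv (x + s) bp hi); rewrite /cv => <-.
  by apply: eq_Rint => t; congr (p _ * _); ring.
rewrite -(cvBr x bp his hi).
apply: (le_trans (norm_cv_le x bp (integB his hi))).
apply: (@le_trans _ _ (M * (e / (M + 1)))); first by rewrite ler_wpM2l// hd.
by rewrite mulrC; apply: div_succ_le => //; exact: ltW.
Qed.

Lemma wiener_tauberian (p f h : R -> R) M s : bm p M -> integ f ->
  cv p f x @[x --> +oo] --> 0 -> (forall x, 0 < x -> 0 < power f x) ->
  integ h -> lsup (fun x => cv p h (x + s) - cv p h x) 0.
Proof.
move=> bp fi pf0 fpos hi.
pose u := cv p h; have bu := bm_cv bp hi.
pose c := \int[mu]_t splk 1 t; have c0 : 0 < c := splk_int_gt0.
suff H e : 0 < e -> lsup (fun x => c * (u (x + s) - u x)) (3 * e).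
  apply: lsup_small => e e0; rewrite add0r => e' e'0.
  have ce : 0 < c * e / 3 by rewrite divr_gt0// mulr_gt0.
  have ce' : 0 < c * e' by rewrite mulr_gt0.
  have := H _ ce _ ce'; apply: filterS => x.
  rewrite normrM (gtr0_norm c0) => ux; rewrite -(ler_pM2l c0); apply: (le_trans ux).
  by rewrite mulrDr lerD2r le_eqVlt; apply/orP; left; apply/eqP; field.
move=> e0.
have iV : integ (splk 1 : R -> R) := integ_splk (@ltr01 R).
have [l0 l0_ hl] := cv_dil_high bu iV e0 (fun e e0 => cv_unif_continuous bp hi e0).
have [m0 m0_ hm] := cv_dil_low s bu iV e0.
(* The 1 and the 2 ensure [m < l]. *)
pose m := Num.min m0 1; pose l := Num.max l0 2.
have mp : 0 < m by rewrite lt_min m0_ ltr01.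
have mm0 : m <= m0 by rewrite ge_min lexx.
have ll0 : l0 <= l by rewrite le_max lexx.
have ml : m < l.
  by apply: (@le_lt_trans _ _ 1); rewrite ?ge_min ?lexx ?orbT// lt_max ltr1n orbT.
have lp := lt_trans mp ml.
have El n : 0 < n -> splk n = dil (splk 1) n by move=> n0; apply/funext => t; exact: splk_scale.
have iVl := integ_splk lp; have iVm := integ_splk mp.
have k0 := splkB_local bp fi pf0 mp ml fpos.
have ik := integB iVl iVm.
have u0 : lsup (cv u (fun x => splk l x - splk m x)) 0.
  have -> : cv u (fun x => splk l x - splk m x) = cv (cv p (fun x => splk l x - splk m x)) h.
    by apply/funext => x; exact: cv_comm bp hi ik.
  by have := lsup_cv (bm_cv bp ik) hi (lexx 0) k0; rewrite mul0r.
pose r x := cv u (splk l) x - c * u x.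
have rb : lsup r e.
  move=> e' e'0; apply: nearW => x.
  by rewrite /r (El _ lp) (le_trans (hl _ ll0 x))// lerDl ltW.
pose v x := cv u (splk m) (x + s) - cv u (splk m) x.
have vb : lsup v e.
  move=> e' e'0; apply: nearW => x.
  by rewrite /v (El _ mp) (le_trans (hm _ mp mm0 x))// lerDl ltW.
(* With dots for convolutions, [c u = u.(V_l - V_m) + u.V_m - r]. In the increment by [s] the first
   term tends to 0, the second contributes [e], and [r] contributes [e] at each of the two points:
   [3 * e] in all. *)
have := lsupB (lsupD (lsupB (lsup_shift s u0) u0) (lsupD vb rb)) (lsup_shift s rb).
have -> : (fun x => cv u (fun t => splk l t - splk m t) (x + s)
    - cv u (fun t => splk l t - splk m t) x + (v x + r x) - r (x + s)) =
    (fun x => c * (u (x + s) - u x)).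
  apply/funext => x; rewrite !(cvBr _ bu iVl iVm) /v /r mulrBr.
  move: (c * u (x + s)) (c * u x) (cv u (splk l) (x + s)) (cv u (splk l) x)
    (cv u (splk m) (x + s)) (cv u (splk m) x) => a1 a2 a3 a4 a5 a6.
  ring.
apply: lsup_le; lra.
Qed.

End Wiener.

(** * Averages of slowly varying functions, and kernels of mean zero *)

Section MeanZero.
Context {R : realType}.
Local Notation mu := (@lebesgue_measure R).

(** For each fixed [t] the increment [u (x - t) - u x] tends to 0, and [2 * C * |k t|] dominates. *)
Lemma cv_average (u k : R -> R) C : bm u C -> integ k ->
  (forall s, lsup (fun x => u (x + s) - u x) 0) ->
  cv u k x - (\int[mu]_t k t) * u x @[x --> +oo] --> 0.
Proof.
move=> bu ki us; have [mu_ uC] := bu.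
have ik (x : R) : integ (fun t => k t * u x).
  by apply: (integ_Mbm (u := fun=> u x) (M := C) ki); split.
have -> : (fun x => cv u k x - (\int[mu]_t k t) * u x) =
    (fun x => \int[mu]_t ((u (x - t) - u x) * k t)).
  apply/funext => x; rewrite -(RintegralZr _ measurableT ki).
  rewrite -(RintegralB measurableT (integ_cv x bu ki) (ik x)).
  by apply: eq_Rint => t; rewrite mulrBl [k t * _]mulrC.
rewrite [X in _ --> X](_ : 0 = \int[mu]_t (0 : R)); last by rewrite Rintegral_cst// mul0r.
apply: (@dct_pinfty _ (fun x t => (u (x - t) - u x) * k t) _ (fun t => 2 * C * `|k t|)).
- move=> x; apply: measurable_funM; last exact: integ_meas.
  by apply: measurable_funB => //; exact: (bm_refl x bu).1.
- exact/integZ/integ_norm.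
- move=> x t; rewrite normrM ler_wpM2r//; apply: (le_trans (ler_normB _ _)).
  by have := uC (x - t); have := uC x; lra.
- move=> t; rewrite -[X in _ --> X](mul0r (k t)); apply: cvgMl.
  exact/lsup0P/(us (- t)).
Qed.

(* Averaging [p] by [h] and by [K] gives the same result in either order. *)
Lemma mean_zero (p h K : R -> R) M : bm p M -> integ h -> integ K -> \int[mu]_t K t = 1 ->
  (forall h s, integ h -> lsup (fun x => cv p h (x + s) - cv p h x) 0) ->
  cv p h x - (\int[mu]_t h t) * cv p K x @[x --> +oo] --> 0.
Proof.
move=> bp hi Ki K1 C1.
have a1 := cv_average (bm_cv bp hi) Ki (fun s => C1 h s hi).
have a2 := cv_average (bm_cv bp Ki) hi (fun s => C1 K s Ki).
rewrite K1 in a1.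
have -> : (fun x => cv p h x - (\int[mu]_t h t) * cv p K x) =
    (fun x => (cv (cv p K) h x - (\int[mu]_t h t) * cv p K x)
       - (cv (cv p h) K x - 1 * cv p h x)).
  by apply/funext => x; rewrite mul1r (cv_comm x bp hi Ki) opprB [RHS]addrC subrKA.
by rewrite -[X in _ --> X](subr0 0); apply: cvgB.
Qed.

End MeanZero.

(** * Upper limits at infinity in the extended reals *)

Section Limsup.
Context {R : realType}.
Implicit Types a b : R -> R.

Local Notation ls a := (limf_esup (fun x : R => ((a : R -> R) x)%:E) +oo%R).

Lemma limf_esup_le_near a b : (forall e, 0 < e -> \forall x \near +oo, a x <= b x + e) ->
  (ls a <= ls b)%E.
Proof.
move=> ab; apply: le_ereal_inf_tmp => _ [B FB <-].
apply/lee_addgt0Pr => e e0.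
apply: (@le_trans _ _ (ereal_sup ((fun x : R => (a x)%:E) @` (B `&` [set x | a x <= b x + e])))).
  apply: ereal_inf_lbound; exists (B `&` [set x | a x <= b x + e]) => //.
  by apply: filterI => //; exact: ab.
apply: ub_ereal_sup => _ [x [Bx /= abx] <-].
apply: (@le_trans _ _ ((b x)%:E + e%:E)%E); first by rewrite -EFinD lee_fin.
by rewrite leeD2r//; apply: ereal_sup_ubound; exists x.
Qed.

Lemma limf_esup_eq a b : a x - b x @[x --> +oo] --> 0 -> ls a = ls b.
Proof.
move=> /cvgr0Pnorm_le ab; apply/eqP; rewrite eq_le; apply/andP; split;
  apply: limf_esup_le_near => e e0; have := ab _ e0; apply: filterS => x;
  rewrite ler_norml => /andP[h1 h2]; lra.
Qed.

Lemma limf_esup_cst (c : R) : ls (fun=> c) = c%:E.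
Proof.
have E (B : set R) : B !=set0 -> ereal_sup ((fun _ : R => c%:E) @` B) = c%:E.
  move=> [x Bx]; rewrite (_ : _ @` B = [set c%:E]) ?ereal_sup1//.
  by apply/seteqP; split=> [_ [y _ <-]//|_ ->]; exists x.
apply/eqP; rewrite eq_le; apply/andP; split.
  apply: ereal_inf_lbound; exists setT; first exact: filterT.
  by apply: E; exists 0.
apply: le_ereal_inf_tmp => _ [B FB <-]; rewrite E//.
exact: (@filter_ex _ +oo%R).
Qed.

Lemma limf_esup_cvg a (l : R) : a x @[x --> +oo] --> l -> ls a = l%:E.
Proof.
move=> al; rewrite -limf_esup_cst; apply: limf_esup_eq.
by rewrite -[X in _ --> X](subrr l); apply: cvgB => //; exact: cvg_cst.
Qed.

Lemma limf_esup_near a (l e : R) : ls a = l%:E -> 0 < e ->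
  \forall x \near +oo, a x <= l + e.
Proof.
move=> al e0.
have : (ls a < (l + e)%:E)%E by rewrite al lte_fin ltrDl.
move=> /ereal_inf_lt[_ [B FB <-] Bl]; apply: filterS FB => x Bx.
rewrite -lee_fin; apply: le_trans (ltW Bl).
by apply: ereal_sup_ubound; exists x.
Qed.

Lemma cvg_of_limf_esup a (l : R) : ls a = l%:E -> ls (fun x => - a x) = (- l)%:E ->
  a x @[x --> +oo] --> l.
Proof.
move=> al nal; apply/cvgrPdist_le => e e0.
have := limf_esup_near nal e0; have := limf_esup_near al e0.
by apply: filterS2 => x h1 h2; rewrite ler_norml; lra.
Qed.

End Limsup.

(** * From classes in L1 and L-infinity to bounded representatives and plain convolutions *)

Section Representatives.
Context {R : realType}.
Local Notation mu := (@lebesgue_measure R).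

Lemma negligible_affine (a b : R) (A : set R) : a != 0 -> mu.-negligible A ->
  mu.-negligible [set x | A (a * x + b)].
Proof.
move=> a0 [B [mB B0 AB]]; exists [set x | B (a * x + b)]; split.
- rewrite -[X in measurable X]setTI.
  exact: (measurable_affine a b measurableT mB).
- apply: (etrans (pushforward_affine b a0 mB)).
  by rewrite /mscale/= B0 mule0.
- by move=> x /= /AB.
Qed.

Lemma ae_impl (P Q : R -> Prop) : (forall x, P x -> Q x) ->
  (\forall x \ae mu, P x) -> (\forall x \ae mu, Q x).
Proof. by move=> PQ; apply: negligibleS => x /=; apply: contra_not; exact: PQ. Qed.

Lemma Rint_ae (D : set R) (f g : R -> R) : measurable D ->
  measurable_fun [set: R] f -> measurable_fun [set: R] g ->
  (\forall x \ae mu, f x = g x) -> \int[mu]_(x in D) f x = \int[mu]_(x in D) g x.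
Proof.
move=> mD mf mg fg; congr fine; apply: ae_eq_integral => //.
- by apply/measurable_EFinP; exact: measurable_funS mf.
- by apply/measurable_EFinP; exact: measurable_funS mg.
- by apply: ae_impl fg => x -> _.
Qed.

(** Clamping at an essential bound makes it hold at every point, as [bm] demands. *)
Lemma Linfty_rep (phi : Linfty R) : exists (p : R -> R) (M : R), bm p M /\
  (\forall x \ae mu, phi x = p x).
Proof.
have [M phiM] := Linfty_bounded phi.
have mphi : measurable_fun [set: R] phi by have /andP[] := LfunP phi; rewrite inE.
pose N := Num.max M 0.
exists (fun x => Num.max (- N) (Num.min (phi x) N)), N.
have N0 : 0 <= N by rewrite le_max lexx orbT.
split; first split.
- by apply: measurable_maxr => //; exact: measurable_minr.
- move=> x; rewrite ler_norml le_max lexx/= ge_max ge_min lexx orbT andbT; lra.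
- apply: ae_impl phiM => x phix; have : `|phi x| <= N by rewrite le_max phix.
  by rewrite ler_norml => /andP[h1 h2]; rewrite min_l// max_r.
Qed.

Lemma L1_integ (f : L1 R) : integ f.
Proof. exact/Lfun1_integrable/LfunP. Qed.

Definition L1_of (f : R -> R) (fi : integ f) : L1 R :=
  Lfun_Sub (lexx _) ((Lfun1_integrable mu f).2 fi).

Section BoundedRepresentative.
Variables (phi : Linfty R) (p : R -> R) (M : R).
Hypothesis bp : bm p M.
Hypothesis php : \forall x \ae mu, phi x = p x.

Let mphi : measurable_fun [set: R] phi.
Proof. by have /andP[] := LfunP phi; rewrite inE. Qed.

Lemma rep_affine (a b : R) : a != 0 -> \forall x \ae mu, phi (a * x + b) = p (a * x + b).
Proof. by move=> a0; exact: (negligible_affine b a0 php). Qed.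

Lemma rep_cv (f : R -> R) (x : R) : integ f -> \int[mu]_t (phi (x - t) * f t) = cv p f x.
Proof.
move=> fi; apply: Rint_ae => //.
- apply: measurable_funM; last exact: integ_meas.
  by apply: (measurableT_comp mphi); exact: measurable_funB.
- exact: integ_meas (integ_cv x bp fi).
- have n1 : -1 != 0 :> R by rewrite oppr_eq0 oner_neq0.
  have := rep_affine x n1; apply: ae_impl => t.
  by rewrite mulN1r addrC => ->.
Qed.

(** Pairing a translate with [f] is convolving with the reflection of [f]. As reflection permutes
    the integrable functions, weak-star convergence becomes a statement about all convolutions. *)
Lemma rep_pairing (f : R -> R) (x : R) : integ f ->
  \int[mu]_t (phi (t + x) * f t) = cv p (reflect_fun f) x.
Proof.
move=> fi; have gi : integ (fun t => p (x + t) * f t).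
  have := integ_reflect (integ_cv x bp (integ_reflect fi)).
  congr (mu.-integrable _ _); apply/funext => t /=.
  by rewrite /reflect_fun !opprK.
rewrite [RHS](_ : _ = \int[mu]_t (p (x + t) * f t)); last exact: (Rint_reflect gi).
apply: Rint_ae => //; last 2 first.
- exact: integ_meas gi.
- have := rep_affine x (@oner_neq0 R); apply: ae_impl => t.
  by rewrite mul1r [x + t]addrC => ->.
apply: measurable_funM; last exact: integ_meas.
exact: (measurableT_comp mphi (measurable_translation x)).
Qed.

Lemma W_rep (alpha : R) : W phi alpha <->
  forall f, integ f -> cv p f x @[x --> +oo] --> alpha * \int[mu]_t f t.
Proof.
have E (f : L1 R) : (fun s => \int[mu]_x (phi (x + s) * f x)) = cv p (reflect_fun f).
  by apply/funext => s; rewrite rep_pairing//; exact: L1_integ.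
split=> [/WP Wphi f fi|Wp].
  have r'i := integ_reflect fi; have := Wphi (L1_of r'i); rewrite E.
  rewrite (_ : reflect_fun (L1_of r'i) = f); last first.
    by apply/funext => t; rewrite /reflect_fun/= /reflect_fun opprK.
  by rewrite RintegralZl//= (Rint_reflect fi).
apply/WP => f; have fi := L1_integ f; rewrite E RintegralZl// -(Rint_reflect fi).
exact: Wp (integ_reflect fi).
Qed.

(* Averaging kernel: [cv p (avk theta) x] is the mean of [p] over
   [x, x + theta]. *)
Definition avk (theta : R) : R -> R := (fun=> theta^-1) \_ `[- theta, 0].

Lemma integ_avk theta : integ (avk theta).
Proof. by apply: within_itv_integ => t; exact: cvg_cst. Qed.

Lemma Rint_avk theta : 0 < theta -> \int[mu]_t avk theta t = 1.
Proof.
move=> t0; rewrite /avk -Rintegral_mkcond Rintegral_cst//= lebesgue_measure_itv/=.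
by rewrite lte_fin oppr_lt0 t0 -EFinD/= opprK add0r mulVf// gt_eqF.
Qed.

Lemma average_rep theta x : 0 < theta ->
  theta^-1 * \int[mu]_(t in `[x, x + theta]) phi t = cv p (avk theta) x.
Proof.
move=> t0.
have Ai := integ_Mbm (integ_refl x (integ_avk theta)) bp.
have eqv t : (- theta <= x - t <= 0) = (x <= t <= x + theta).
  by apply/idP/idP => /andP[? ?]; apply/andP; split; lra.
have -> : cv p (avk theta) x = \int[mu]_t (avk theta (x - t) * p t).
  rewrite -(Rint_refl x Ai); apply: eq_Rint => t.
  by rewrite mulrC; congr (avk _ _ * _); ring.
rewrite (Rint_ae _ mphi bp.1 php)// Rintegral_mkcond -RintegralZl//.
  apply: eq_Rint => t; rewrite /avk !patchE !mem_setE !in_itv/=.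
  by rewrite eqv; case: ifPn => // _; rewrite -[point]/(0 : R) mulr0 mul0r.
have := integZ theta Ai; congr (mu.-integrable _ _); apply/funext => t /=; congr EFin.
rewrite /avk !patchE !mem_setE !in_itv/=.
rewrite eqv; case: ifPn => _; last by rewrite -[point]/(0 : R) mul0r mulr0.
by rewrite mulrA divff ?mul1r// gt_eqF.
Qed.

Lemma Pupper_rep (l : \bar R) : (forall theta, 0 < theta ->
    limf_esup (fun x => (cv p (avk theta) x)%:E) +oo%R = l) ->
  Pupper phi = l.
Proof.
move=> H; apply: cvg_lim; first exact: ereal_hausdorff.
apply: cvg_near_cst; near=> theta.
have t0 : 0 < theta by near: theta; exact: nbhs_pinfty_gt.
rewrite -(H theta t0).
by congr (limf_esup _ _); apply/funext => x; rewrite average_rep.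
Unshelve. all: by end_near. Qed.

End BoundedRepresentative.

Section Conditions.
Variables (phi : Linfty R) (p : R -> R) (M : R).
Hypothesis bp : bm p M.
Hypothesis php : \forall x \ae mu, phi x = p x.

Lemma bm_opp : bm (fun x => - p x) M.
Proof.
split; first by apply: measurableT_comp => //; exact: bp.1.
by move=> x; rewrite normrN; exact: bp.2.
Qed.

Lemma rep_opp : \forall x \ae mu, (- phi)%R x = - p x.
Proof. by apply: ae_impl php => x /= <-. Qed.

Lemma cv_opp f x : integ f -> cv (fun x => - p x) f x = - cv p f x.
Proof.
move=> fi; rewrite /cv -[RHS]mulN1r -RintegralZl//; last exact: integ_cv bp fi.
by apply: eq_Rint => t; rewrite mulN1r mulNr.
Qed.

Lemma condition1_rep : condition1 phi <->
  forall h s, integ h -> lsup (fun x => cv p h (x + s) - cv p h x) 0.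
Proof.
have bps (s : R) : bm (fun x => p (x + s) - p x) (M + M).
  have [mp pM] := bp; split.
    apply: measurable_funB => //.
    exact: (measurableT_comp mp (measurable_translation s)).
  by move=> x; apply: (le_trans (ler_normB _ _)); exact: lerD.
have rps (s : R) : \forall x \ae mu, (translate s phi - phi)%R x = p (x + s) - p x.
  have := negligibleU php (rep_affine php s (@oner_neq0 R)).
  apply: negligibleS => x /= nx; apply: contrapT => /not_orP[/contrapT h1 /contrapT].
  by rewrite mul1r => h2; apply: nx; rewrite -h1 -h2.
have E (s : R) f x : integ f -> cv (fun x => p (x + s) - p x) f x = cv p f (x + s) - cv p f x.
  move=> fi; rewrite (cvBl x (M := M) (M' := M)) //.
    by congr (_ - _); apply: eq_Rint => t; congr (p _ * _); ring.
  have [mp pM] := bp; split=> //.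
  exact: (measurableT_comp mp (measurable_translation s)).
split=> [C1 h s hi|C1 s].
  have /(W_rep (bps s) (rps s))/(_ h hi) := C1 s.
  rewrite mul0r => /lsup0P; congr (lsup _ _); apply/funext => x; exact: E.
apply/(W_rep (bps s) (rps s)) => f fi; rewrite mul0r; apply/lsup0P.
have := C1 f s fi; congr (lsup _ _); apply/funext => x; exact/esym/E.
Qed.

Lemma fourierE (f : L1 R) xi : fourier f xi = (cosT f xi +i* - sinT f xi)%C.
Proof.
have fi := L1_integ f; rewrite /fourier /cintegral; congr (_ +i* _)%C.
  by apply: eq_Rint => x /=; rewrite cosN mul0r subr0.
rewrite /sinT -[RHS]mulN1r -RintegralZl//; last exact: integ_sinM.
by apply: eq_Rint => x /=; rewrite sinN mul0r addr0 mulN1r mulrN.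
Qed.

Lemma Rint_fourier1 (f : L1 R) : fourier f 0 = 1 -> \int[mu]_t f t = 1.
Proof.
rewrite fourierE => -[f1 _]; apply: etrans f1.
by apply: eq_Rint => t; rewrite mul0r cos0 mulr1.
Qed.

Lemma fourier_eq0 (f : L1 R) xi : fourier f xi = 0 <-> power f xi = 0.
Proof.
rewrite fourierE.
split=> [[c0 /eqP]|].
  by rewrite oppr_eq0 /power c0 => /eqP ->; rewrite !expr0n/= addr0.
move/eqP; rewrite /power paddr_eq0 ?sqr_ge0// !sqrf_eq0 => /andP[/eqP -> /eqP ->].
by rewrite oppr0.
Qed.

Lemma convolution_rep (f : L1 R) : convolution phi f = cv p f.
Proof. by apply/funext => x; exact: (rep_cv bp php x (L1_integ f)). Qed.

Lemma condition2_rep : condition2 phi <->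
  exists2 f, integ f & (forall xi, power f xi = 0 <-> xi = 0) /\
    cv p f x @[x --> +oo] --> 0.
Proof.
split=> [[f [Zf]]|[f fi [Zf f0]]].
  rewrite convolution_rep => f0; exists f; first exact: L1_integ.
  split=> // xi; rewrite -fourier_eq0.
  by rewrite -[fourier f xi = 0]/(Z f xi) Zf.
exists (L1_of fi); split; last by rewrite convolution_rep.
by apply/seteqP; split=> xi /=; rewrite /Z/= fourier_eq0; [move/Zf|move=> ->; exact/Zf].
Qed.

End Conditions.
End Representatives.

(** * A kernel vanishing only at frequency 0, and the equivalences *)

Section WienerKernels.
Context {R : realType}.
Local Notation mu := (@lebesgue_measure R).

(** The integrals of [expk 1] and [expk 2] are 2 and 1, so the factor [2^-1] makes the mean zero.
    The transform is [1 / (1 + xi ^+ 2) - 4 / (4 + xi ^+ 2)], whose numerator reduces to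
    [- 3 * xi ^+ 2]. *)
Definition null_kernel (x : R) : R := 2^-1 * expk 1 x - expk 2 x.

Lemma integ_null_kernel : integ null_kernel.
Proof. by apply: integB; [apply: integZ|]; exact: integ_expk. Qed.

Lemma cosT_null_kernel (xi : R) :
  cosT null_kernel xi = - (3 * xi ^+ 2) / ((1 + xi ^+ 2) * (4 + xi ^+ 2)).
Proof.
have i1 := integ_expk (@ltr01 R); have i2 := integ_expk (@ltr0n R 2).
rewrite /cosT (_ : (fun _ => _) =
  (fun y => 2^-1 * (expk 1 y * cos (xi * y)) - expk 2 y * cos (xi * y))); last first.
  by apply/funext => y; rewrite /null_kernel mulrBl mulrA.
rewrite RintegralB//; last 2 first.
- exact/integZ/integ_cosM.
- exact: integ_cosM.
rewrite RintegralZl//; last exact: integ_cosM.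
rewrite -!/(cosT _ _) !cosT_expk//.
have h1 : 0 < 1 + xi ^+ 2 by rewrite ltr_pwDl ?sqr_ge0.
have h4 : 0 < 4 + xi ^+ 2 by rewrite ltr_pwDl ?sqr_ge0.
rewrite expr1n (_ : 2 ^+ 2 = 4 :> R); last by ring.
by field; rewrite !gt_eqF.
Qed.

Lemma sinT_null_kernel (xi : R) : sinT null_kernel xi = 0.
Proof.
have := sinT_reflect xi integ_null_kernel.
rewrite (_ : reflect_fun null_kernel = null_kernel); last first.
  by apply/funext => x; rewrite /reflect_fun /null_kernel /expk normrN.
lra.
Qed.

Lemma power_null_kernel (xi : R) : power null_kernel xi = 0 <-> xi = 0.
Proof.
have h1 : 0 < 1 + xi ^+ 2 by rewrite ltr_pwDl ?sqr_ge0.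
have h4 : 0 < 4 + xi ^+ 2 by rewrite ltr_pwDl ?sqr_ge0.
rewrite /power sinT_null_kernel cosT_null_kernel expr0n/= addr0; split=> [/eqP|->]; last first.
  by rewrite expr0n/= mulr0 oppr0 mul0r expr0n.
rewrite sqrf_eq0 mulf_eq0 invr_eq0 (gt_eqF (mulr_gt0 h1 h4)) orbF oppr_eq0.
by rewrite mulf_eq0 sqrf_eq0 pnatr_eq0/= => /eqP.
Qed.

Variables (phi : Linfty R) (p : R -> R) (M : R).
Hypothesis bp : bm p M.
Hypothesis php : \forall x \ae mu, phi x = p x.

Lemma condition12 : condition1 phi <-> condition2 phi.
Proof.
split=> [/(condition1_rep bp php) C1|/(condition2_rep bp php)[f fi [Zf f0]]].
  apply/(condition2_rep bp php); exists null_kernel; first exact: integ_null_kernel.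
  split; first exact: power_null_kernel.
  have := mean_zero bp integ_null_kernel (integ_avk 1) (Rint_avk ltr01) C1.
  have -> : \int[mu]_t null_kernel t = 0.
    transitivity (cosT null_kernel 0).
      by apply: eq_Rint => t; rewrite mul0r cos0 mulr1.
    by rewrite cosT_null_kernel expr0n/= mulr0 oppr0 mul0r.
  by under eq_fun do rewrite mul0r subr0.
apply/(condition1_rep bp php) => h s hi.
apply: (wiener_tauberian s bp fi f0 _ hi) => x x0.
rewrite lt_neqAle addr_ge0 ?sqr_ge0// andbT eq_sym; apply/eqP => /Zf x_0.
by rewrite x_0 ltxx in x0.
Qed.

(** A window mean is a convolution with a kernel of integral 1, so it converges to [alpha] for each
    fixed length, before any limit in [theta]. *)
Lemma P_of_W alpha : W phi alpha -> P phi alpha.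
Proof.
move=> /(W_rep bp php) Wp; split.
  apply: (Pupper_rep bp php) => theta t0; apply: limf_esup_cvg.
  by have := Wp _ (integ_avk theta); rewrite Rint_avk// mulr1.
rewrite /Plower; have -> : Pupper (- phi) = (- alpha)%:E; last by rewrite EFinN oppeK.
apply: (Pupper_rep (bm_opp bp) (rep_opp php)) => theta t0; apply: limf_esup_cvg.
have -> : cv (fun x => - p x) (avk theta) = (fun x => - cv p (avk theta) x).
  by apply/funext => x; exact: (cv_opp bp x (integ_avk theta)).
by apply: cvgN; have := Wp _ (integ_avk theta); rewrite Rint_avk// mulr1.
Qed.

Lemma condition1_of_W alpha : W phi alpha -> condition1 phi.
Proof.
move=> /(W_rep bp php) Wp; apply/(condition1_rep bp php) => h s hi.
have cv0 : lsup (fun x => cv p h x - alpha * \int[mu]_t h t) 0.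
  apply/lsup0P; rewrite -[X in _ --> X](subrr (alpha * \int[mu]_t h t)).
  by apply: cvgB; [exact: Wp|exact: cvg_cst].
have := lsupB (lsup_shift s cv0) cv0; rewrite addr0.
by congr (lsup _ _); apply/funext => x; ring.
Qed.

(* Under condition (1) all the averages over windows of length [theta] have the
   same upper limit, so that the outer limit defining [Pupper] is that of a
   constant. *)
Lemma W_of_P alpha : condition1 phi -> P phi alpha -> W phi alpha.
Proof.
move=> /(condition1_rep bp php) C1 [Pu Pl].
have K1 := Rint_avk (@ltr01 R); have Ki := integ_avk (1 : R).
have same theta : 0 < theta ->
    cv p (avk theta) x - cv p (avk 1) x @[x --> +oo] --> 0.
  move=> t0; have := mean_zero bp (integ_avk theta) Ki K1 C1.
  by rewrite Rint_avk//; under eq_fun do rewrite mul1r.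
have up : limf_esup (fun x => (cv p (avk 1) x)%:E) +oo%R = alpha%:E.
  rewrite -Pu; apply/esym; apply: (Pupper_rep bp php) => theta t0.
  by apply: limf_esup_eq; exact: same.
have low : limf_esup (fun x => (- cv p (avk 1) x)%:E) +oo%R = (- alpha)%:E.
  rewrite EFinN -Pl /Plower oppeK; apply/esym.
  apply: (Pupper_rep (bm_opp bp) (rep_opp php)) => theta t0.
  apply: limf_esup_eq.
  have -> : (fun x => cv (fun x => - p x) (avk theta) x - - cv p (avk 1) x) =
      (fun x => - (cv p (avk theta) x - cv p (avk 1) x)).
    by apply/funext => x; rewrite (cv_opp bp x (integ_avk theta)); ring.
  by rewrite -oppr0; apply: cvgN; exact: same.
(* The means over unit windows have upper and lower limit [alpha], hence converge; [mean_zero]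
   carries this over from that one kernel to every integrable [f]. *)
have cvK := cvg_of_limf_esup up low.
apply/(W_rep bp php) => f fi.
have m0 := mean_zero bp fi Ki K1 C1.
have -> : cv p f = (fun x => cv p f x - (\int[mu]_t f t) * cv p (avk 1) x
    + (\int[mu]_t f t) * cv p (avk 1) x).
  by apply/funext => x; rewrite subrK.
rewrite -[X in _ --> X]add0r; apply: cvgD => //.
by rewrite [alpha * _]mulrC; apply: cvgM => //; exact: cvg_cst.
Qed.

End WienerKernels.

Theorem theorem5p6 (R : realType) (phi : Linfty R) (alpha : R) :
  [/\ condition1 phi <-> condition2 phi,
      W phi alpha <-> P phi alpha /\ (condition1 phi \/ condition2 phi)
    & condition1 phi \/ condition2 phi -> P phi alpha ->
      forall f : L1 R, Wiener_kernel f -> fourier f 0 = 1 ->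
      convolution phi f x @[x --> +oo%R] --> alpha].
Proof.
have [p [M [bp php]]] := Linfty_rep phi.
have c12 := condition12 bp php.
have c1 : condition1 phi \/ condition2 phi -> condition1 phi by move=> [//|/c12].
split=> // [|/c1 C1 Pa f _ f1].
  split=> [Wa|[Pa /c1 C1]]; last exact: (W_of_P bp php C1 Pa).
  split; first exact: (P_of_W bp php Wa).
  by left; exact: (condition1_of_W bp php Wa).
have /(W_rep bp php)/(_ f (L1_integ f)) := W_of_P bp php C1 Pa.
by rewrite (convolution_rep bp php) (Rint_fourier1 f1) mulr1.
Qed.
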